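(* The following decision problem is undecidable: given a pathograph $\mathfrak{H}$ and a finite set $\mathcal{F}$ of pathographs, is there an $\mathcal{F}$-free realization of $\mathfrak{H}$? Moreover, it remains undecidable when restricted to inputs in which $\mathfrak{H}$ has only one rung and every member of $\mathcal{F}$ has no urpaths (i.e. is a conventional graph).
   Context: All graphs are finite and simple. A pathograph is a tuple $\mathfrak{G}=(V,U,E,S,R,\pi)$ where $V$ (vertices) and $U$ (urpaths) are finite disjoint sets, $E\subseteq\binom{V}{2}$ (edges), $S\subseteq V\times U$ (spokes), $R\subseteq\binom{U}{2}$ (rungs), and $\pi:U\to\binom{V}{2}$ assigns to each urpath its two distinct endpoints, with $\pi(U)\cap E=\emptyset$. A graph is regarded as a pathograph with no urpaths, spokes or rungs. A realization of $\mathfrak{G}$ is a graph obtained as follows: start from the graph $(V,E)$; for each urpath $u$ with endpoints $a,b$ add new vertices $x_u^{(1)},\dots,x_u^{(m_u)}$ ($m_u\ge 1$, the internal vertices of $u$) and the edges of the path $a x_u^{(1)}\cdots x_u^{(m_u)} b$; the only further edges added are: for each spoke $(v,u)\in S$, a nonempty set of edges between $v$ and internal vertices of $u$; and for each rung $\{u,u'\}\in R$, a nonempty set of edges between internal vertices of $u$ and internal vertices of $u'$. A graph $G$ contains a pathograph $\mathfrak{F}$ if some induced subgraph of $G$ is isomorphic to a realization of $\mathfrak{F}$; for a set $\mathcal{F}$ of pathographs, $G$ is $\mathcal{F}$-free if it contains no member of $\mathcal{F}$. *)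

(* Defs.v *)
From mathcomp Require Import all_boot.
From Stdlib Require Lists.List.
Set Implicit Arguments. Unset Strict Implicit. Unset Printing Implicit Defensive.

(* V = 'I_nv, U = 'I_nu.  An unordered pair {a,b} (a<b) is stored as    *)
(* the ordered pair (a,b).  pPi is the list of endpoint pairs, one per  *)
(* urpath (entry u gives pi(u)).                                        *)
Record pgraph := PG {
  nv  : nat;
  nu  : nat;
  pE  : seq (nat * nat);   (* edges, as (a,b) with a < b < nv *)
  pS  : seq (nat * nat);   (* spokes (v,u), v < nv, u < nu *)
  pR  : seq (nat * nat);   (* rungs (u,u'), u < u' < nu *)
  pPi : seq (nat * nat)    (* endpoints pi(u) = (a,b), a < b < nv *)
}.

Definition wf_pg (P : pgraph) : bool :=
  [&& all (fun e => (e.1 < e.2) && (e.2 < nv P)) (pE P), uniq (pE P),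
      all (fun s => (s.1 < nv P) && (s.2 < nu P)) (pS P), uniq (pS P),
      all (fun r => (r.1 < r.2) && (r.2 < nu P)) (pR P), uniq (pR P),
      size (pPi P) == nu P,
      all (fun e => (e.1 < e.2) && (e.2 < nv P)) (pPi P)
    & all (fun e => e \notin pE P) (pPi P)].

Definition pedge (P : pgraph) (v w : nat) : bool :=
  ((v, w) \in pE P) || ((w, v) \in pE P).
Definition prung (P : pgraph) (u u' : nat) : bool :=
  ((u, u') \in pR P) || ((u', u) \in pR P).
Definition ppi (P : pgraph) (u : nat) : nat * nat := nth (0, 0) (pPi P) u.

(* Realizations.  Given path lengths m u (number of internal vertices), *)
(* the vertex set of a realization is V plus the internal vertices      *)
(* (u,i), i < m u, where (u,i) stands for x_u^(i+1).                    *)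
Definition rvert (P : pgraph) (m : 'I_(nu P) -> nat) : finType :=
  ('I_(nv P) + {u : 'I_(nu P) & 'I_(m u)})%type.

Definition ivert (P : pgraph) (m : 'I_(nu P) -> nat) (u : 'I_(nu P))
  (i : 'I_(m u)) : rvert m := inr (Tagged (fun u => 'I_(m u)) i).

Definition pathend (P : pgraph) (m : 'I_(nu P) -> nat) (v : 'I_(nv P))
  (u : 'I_(nu P)) (i : 'I_(m u)) : bool :=
  (((v : nat) == (ppi P u).1) && ((i : nat) == 0))
  || (((v : nat) == (ppi P u).2) && ((i : nat) == (m u).-1)).

Definition is_realization (P : pgraph) (m : 'I_(nu P) -> nat)
  (adj : rel (rvert m)) : Prop :=
  (forall u, 0 < m u) /\
      symmetric adj /\ irreflexive adj /\
      (forall v w : 'I_(nv P), adj (inl v) (inl w) = pedge P v w) /\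
      (forall v u (i : 'I_(m u)), @pathend P m v u i -> adj (inl v) (ivert i)) /\
      (forall v u (i : 'I_(m u)), ~~ @pathend P m v u i ->
          adj (inl v) (ivert i) -> ((v : nat), (u : nat)) \in pS P) /\
      (forall (v : 'I_(nv P)) (u : 'I_(nu P)), ((v : nat), (u : nat)) \in pS P ->
          exists i : 'I_(m u), ~~ @pathend P m v u i && adj (inl v) (ivert i)) /\
      (forall u (i j : 'I_(m u)),
          adj (ivert i) (ivert j) = ((i : nat).+1 == j) || ((j : nat).+1 == i)) /\
      (forall u u' (i : 'I_(m u)) (j : 'I_(m u')), u != u' ->
          adj (ivert i) (ivert j) -> prung P u u') /\
      (forall u u' : 'I_(nu P), ((u : nat), (u' : nat)) \in pR P ->
          exists (i : 'I_(m u)) (j : 'I_(m u')), adj (ivert i) (ivert j)).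

Definition contains (T : finType) (adj : rel T) (F : pgraph) : Prop :=
  exists (m : 'I_(nu F) -> nat) (adjF : rel (rvert m)),
    @is_realization F m adjF /\
    exists f : rvert m -> T,
      injective f /\ forall x y, adjF x y = adj (f x) (f y).

Definition has_free_realization (H : pgraph) (Fs : seq pgraph) : Prop :=
  exists (m : 'I_(nu H) -> nat) (adj : rel (rvert m)),
    @is_realization H m adj /\ forall F, Stdlib.Lists.List.In F Fs -> ~ contains adj F.

Definition cpair (x y : nat) : nat := ((x + y) * (x + y).+1) %/ 2 + y.

Fixpoint code_seq (s : seq nat) : nat :=
  if s is x :: s' then (cpair x (code_seq s')).+1 else 0.

Definition code_pairs (s : seq (nat * nat)) : nat :=
  code_seq (map (fun p => cpair p.1 p.2) s).

Definition code_pg (P : pgraph) : nat :=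
  code_seq [:: nv P; nu P; code_pairs (pE P); code_pairs (pS P);
               code_pairs (pR P); code_pairs (pPi P)].

Definition code_inst (H : pgraph) (Fs : seq pgraph) : nat :=
  cpair (code_pg H) (code_seq (map code_pg Fs)).

(* Model of computation: counter (Minsky) machines, Turing complete.    *)
Inductive instr := INC of nat | DEC of nat & nat.

Definition cstate := (nat * (nat -> nat))%type.

Definition upd (r : nat -> nat) (k v : nat) : nat -> nat :=
  fun i => if i == k then v else r i.

Definition cstep (p : seq instr) (s : cstate) : cstate :=
  let: (pc, r) := s in
  if pc < size p then
    match nth (INC 0) p pc with
    | INC k => (pc.+1, upd r k (r k).+1)
    | DEC k j => if r k is n.+1 then (pc.+1, upd r k n) else (j, r)
    end
  else s.

Definition cinit (x : nat) : cstate := (0, fun i => if i == 0 then x else 0).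

Definition halts_with (p : seq instr) (x y : nat) : Prop :=
  exists n, let s := iter n (cstep p) (cinit x) in size p <= s.1 /\ s.2 0 = y.

Definition decides_on (restr : pgraph -> seq pgraph -> Prop) (p : seq instr) : Prop :=
  forall H Fs, wf_pg H -> all wf_pg Fs -> restr H Fs ->
    (has_free_realization H Fs -> halts_with p (code_inst H Fs) 1) /\
    (~ has_free_realization H Fs -> halts_with p (code_inst H Fs) 0).

(* Main.v *)
From HB Require Import structures.
Require Import Defs.
From mathcomp Require Import all_boot zify.
From Stdlib Require Import FunctionalExtensionality ClassicalEpsilon.
Set Implicit Arguments. Unset Strict Implicit. Unset Printing Implicit Defensive.

(**
Diagonal argument.  Two urpaths joined by a rung carry a 0/1 matrix (the edges
between their internal vertices), whose columns can record, in unary, the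
counters of a machine running through time; forbidden induced subgraphs of
bounded size impose the local rules of the computation.  Spokes to a few fixed
vertices give the labels that these rules need, and a clique together with
vertices of pairwise different degrees into it makes the fixed vertices
recognizable inside any small induced subgraph.  The state of the machine is
stored in counters as well, so that the host [host x] depends only on the input
[x], held as a path of [x] vertices, and the machine enters only through the
forbidden graphs.

Given a decider [p], let [D] be the program that maps [x] to the code of the
instance formed by [host x] and the list of graphs coded by [x], and then runs
[p].  Feeding [D] with the code [x] of the list of forbidden graphs associated
with [D] itself gives an instance which has a free realization iff [D] answers
0 on [x], that is, iff [p] claims that it has none.
*)

(** * Structured programs for counter machines *)

Definition reach (p : seq instr) (s s' : cstate) : Prop :=
  exists n, iter n (cstep p) s = s'.

Lemma reach_trans p s1 s2 s3 : reach p s1 s2 -> reach p s2 s3 -> reach p s1 s3.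
Proof. by move=> [n <-] [m <-]; exists (m + n); rewrite iterD. Qed.

Lemma reach_step p s s' : cstep p s = s' -> reach p s s'.
Proof. by move=> <-; exists 1. Qed.

Inductive com :=
| Skip
| Incr of nat
| Seq of com & com
| Loop of nat & com.

Notation "c1 ;; c2" := (Seq c1 c2) (at level 60, right associativity).

Fixpoint csize c :=
  match c with
  | Skip => 0
  | Incr _ => 1
  | Seq c1 c2 => csize c1 + csize c2
  | Loop _ c => (csize c).+2
  end.

(* Register 1 is kept equal to 0, so that [DEC 1 b] is an unconditional jump. *)
Fixpoint compile b c :=
  match c with
  | Skip => [::]
  | Incr k => [:: INC k]
  | Seq c1 c2 => compile b c1 ++ compile (b + csize c1) c2
  | Loop k c => DEC k (b + (csize c).+2) :: rcons (compile b.+1 c) (DEC 1 b)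
  end.

Lemma size_compile b c : size (compile b c) = csize c.
Proof.
elim: c b => //= [c1 IH1 c2 IH2|k c IH] b; first by rewrite size_cat IH1 IH2.
by rewrite size_rcons IH.
Qed.

(** The premise [r2 1 = 0] of [exec_loopS] makes the closing [DEC 1 b] of a compiled loop jump back
    instead of falling through. *)
Inductive exec : com -> (nat -> nat) -> (nat -> nat) -> Prop :=
| exec_skip r : exec Skip r r
| exec_incr k r : exec (Incr k) r (upd r k (r k).+1)
| exec_seq c1 c2 r1 r2 r3 :
    exec c1 r1 r2 -> exec c2 r2 r3 -> exec (c1 ;; c2) r1 r3
| exec_loop0 k c r : r k = 0 -> exec (Loop k c) r r
| exec_loopS k c n r1 r2 r3 : r1 k = n.+1 -> exec c (upd r1 k n) r2 ->
    r2 1 = 0 -> exec (Loop k c) r2 r3 -> exec (Loop k c) r1 r3.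

Lemma nth_code (pre post code : seq instr) i : i < size code ->
  nth (INC 0) (pre ++ code ++ post) (size pre + i) = nth (INC 0) code i.
Proof.
move=> lti; rewrite nth_cat ltnNge leq_addr /= addKn nth_cat lti //.
Qed.

(** Jump targets are absolute, so code is compiled for the position where it stands. Quantifying
    over [pre] and [post] after [exec] lets the induction treat a subprogram's surroundings as
    prefix and suffix. *)
Lemma compileP c r r' : exec c r r' -> forall pre post,
  reach (pre ++ compile (size pre) c ++ post)
    (size pre, r) (size pre + csize c, r').
Proof.
elim=> {c r r'} [r|k r|c1 c2 r1 r2 r3 _ IH1 _ IH2|k c r rk0
                |k c n r1 r2 r3 rkS _ IHc r20 _ IHl] pre post.
- by exists 0; rewrite /= addn0.
- apply: reach_step; rewrite /cstep /= ifT; last by rewrite size_cat /=; lia.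
  by rewrite -[X in nth _ _ X](addn0 (size pre)) (nth_code _ _ (code := [:: _])) //= addn1.
- apply: reach_trans (_ : reach _ _ (size pre + csize c1, r2)) _.
    by rewrite /= -catA; apply: IH1.
  have := IH2 (pre ++ compile (size pre) c1) post.
  by rewrite size_cat size_compile /= addnA !catA.
- apply: reach_step; rewrite /cstep /= ifT; last by rewrite size_cat /=; lia.
  by rewrite -[X in nth _ _ X](addn0 (size pre)) nth_cat ltnNge leq_addr /= addKn /= rk0.
- apply: reach_trans (_ : reach _ _ ((size pre).+1, upd r1 k n)) _.
    apply: reach_step; rewrite /cstep /= ifT; last by rewrite size_cat /=; lia.
    by rewrite -[X in nth _ _ X](addn0 (size pre)) nth_cat ltnNge leq_addr /= addKn /= rkS.
  apply: reach_trans (_ : reach _ _ ((size pre).+1 + csize c, r2)) _.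
    have := IHc (rcons pre (DEC k (size pre + (csize c).+2))) (DEC 1 (size pre) :: post).
    by rewrite size_rcons /= !cat_rcons.
  apply: reach_trans (IHl pre post).
  apply: reach_step; rewrite /cstep ifT; last first.
    by rewrite size_cat /= size_cat size_rcons size_compile; lia.
  have -> : (size pre).+1 + csize c = size pre + (csize c).+1 by lia.
  rewrite (nth_code _ _ (code := compile (size pre) (Loop k c))); last first.
    by rewrite size_compile /=; lia.
  by rewrite /= nth_rcons size_compile ltnn eqxx r20.
Qed.

(** Loop rule with an explicit invariant: [R i] is the whole register state after [i] turns. *)
Lemma exec_loop k c (R : nat -> nat -> nat) n r r' :
    r = R 0 -> r' = R n ->
    (forall i, i <= n -> R i k = n - i) ->
    (forall i, i < n -> exec c (upd (R i) k (n - i.+1)) (R i.+1)) ->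
    (forall i, i < n -> R i.+1 1 = 0) ->
  exec (Loop k c) r r'.
Proof.
move=> -> ->; elim: n R => [|n IH] R Rk Rc R1; first by apply: exec_loop0; rewrite Rk.
apply: (@exec_loopS k c n _ (R 1)); first by rewrite Rk.
- by have := Rc 0 isT; rewrite subSS subn0.
- exact: R1.
by apply: (IH (fun i => R i.+1)) => i lti; [rewrite Rk|exact: Rc|apply: R1].
Qed.

Lemma exec_incr_eq k r r' : r' = upd r k (r k).+1 -> exec (Incr k) r r'.
Proof. by move=> ->; apply: exec_incr. Qed.

Ltac upd_cases := rewrite /upd; repeat (case: eqP => ?; subst => //); try lia.
Ltac state_eq := apply: functional_extensionality => ?; upd_cases.

Lemma exec_move a b r : a <> b -> b <> 1 -> r 1 = 0 ->
  exec (Loop a (Incr b)) r (upd (upd r b (r b + r a)) a 0).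
Proof.
move=> nab nb1 r1.
apply: (@exec_loop _ _ (fun i => upd (upd r b (r b + i)) a (r a - i)) (r a)).
- by state_eq.
- by state_eq.
- by move=> i _; rewrite /upd eqxx.
- by move=> i lti; apply: exec_incr_eq; state_eq.
- by move=> i lti; upd_cases.
Qed.

Lemma exec_clear a r : r 1 = 0 -> exec (Loop a Skip) r (upd r a 0).
Proof.
move=> r1; apply: (@exec_loop _ _ (fun i => upd r a (r a - i)) (r a)).
- by state_eq.
- by state_eq.
- by move=> i _; rewrite /upd eqxx.
- move=> i lti; have -> : upd (upd r a (r a - i)) a (r a - i.+1) = upd r a (r a - i.+1).
    by state_eq.
  exact: exec_skip.
- by move=> i lti; upd_cases.
Qed.

Lemma exec_move2 a b c r : a <> b -> a <> c -> b <> c -> b <> 1 -> c <> 1 ->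
    r 1 = 0 ->
  exec (Loop a (Incr b ;; Incr c)) r
    (upd (upd (upd r b (r b + r a)) c (r c + r a)) a 0).
Proof.
move=> nab nac nbc nb1 nc1 r1.
apply: (@exec_loop _ _
  (fun i => upd (upd (upd r b (r b + i)) c (r c + i)) a (r a - i)) (r a)).
- by state_eq.
- by state_eq.
- by move=> i _; rewrite /upd eqxx.
- move=> i lti; apply: exec_seq; first exact: exec_incr.
  by apply: exec_incr_eq; state_eq.
- by move=> i lti; upd_cases.
Qed.

Definition copy a b tmp := Loop a (Incr b ;; Incr tmp) ;; Loop tmp (Incr a).

Lemma exec_copy a b tmp r : a <> b -> a <> tmp -> b <> tmp ->
    a <> 1 -> b <> 1 -> tmp <> 1 -> r 1 = 0 -> r tmp = 0 ->
  exec (copy a b tmp) r (upd r b (r b + r a)).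
Proof.
move=> nab nat nbt na1 nb1 nt1 r1 rt; apply: exec_seq; first by apply: exec_move2.
set r' := upd _ a 0.
have -> : upd r b (r b + r a) = upd (upd r' a (r' a + r' tmp)) tmp 0.
  by rewrite /r'; state_eq.
by apply: exec_move; rewrite /r' //; upd_cases.
Qed.

(** Cantor pairing of registers [t] and [t.+1]. The first loop leaves x + y in [t] and y in [t.+2];
    the second adds 1, 2, ..., x + y to [t.+2]; the last two clear [t.+1] and move the result to
    [t]. *)
Definition pair_com t :=
  Loop t.+1 (Incr t ;; Incr t.+2) ;;
  Loop t (Incr t.+1 ;; copy t.+1 t.+2 t.+3) ;;
  Loop t.+1 Skip ;; Loop t.+2 (Incr t).

Fixpoint triangle n := if n is m.+1 then n + triangle m else 0.

Lemma triangle_double n : 2 * triangle n = n * n.+1.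
Proof. by elim: n => //= n IH; nia. Qed.

Lemma cpairE x y : cpair x y = y + triangle (x + y).
Proof.
rewrite /cpair -triangle_double mulKn //; lia.
Qed.

Lemma exec_pair_com t r : 1 < t -> r 1 = 0 -> (forall i, t.+1 < i -> r i = 0) ->
  exec (pair_com t) r (upd (upd r t (cpair (r t) (r t.+1))) t.+1 0).
Proof.
move=> t1 r1 rt.
have [r2 r3] : r t.+2 = 0 /\ r t.+3 = 0 by rewrite !rt.
apply: exec_seq; first by apply: exec_move2; lia.
pose n := r t + r t.+1.
apply: (exec_seq (r2 := upd (upd (upd r t 0) t.+1 n) t.+2 (cpair (r t) (r t.+1)))).
  apply: (@exec_loop _ _ (fun i =>
    upd (upd (upd r t (n - i)) t.+1 i) t.+2 (r t.+1 + triangle i)) n).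
  - by rewrite /n /=; state_eq.
  - by rewrite cpairE; state_eq.
  - by move=> i _; upd_cases.
  - move=> i lti; apply: exec_seq; first exact: exec_incr.
    set r' := upd _ t.+1 _.
    have -> : upd (upd (upd r t (n - i.+1)) t.+1 i.+1) t.+2 (r t.+1 + triangle i.+1)
      = upd r' t.+2 (r' t.+2 + r' t.+1) by rewrite /r' /=; state_eq.
    by apply: exec_copy; rewrite /r'; try lia; upd_cases.
  - by move=> i lti; upd_cases.
apply: exec_seq; first by apply: exec_clear; upd_cases.
set r' := upd _ t.+1 0.
have -> : upd (upd r t (cpair (r t) (r t.+1))) t.+1 0 =
          upd (upd r' t (r' t + r' t.+2)) t.+2 0 by rewrite /r'; state_eq.
by apply: exec_move; rewrite /r'; try lia; upd_cases.
Qed.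

(** * Arithmetic expressions and their compilation *)

Inductive expr :=
| EVar of nat
| ECst of nat
| ESuc of expr
| EPair of expr & expr
| EIter of expr & expr & expr.

(* Registers below [t] form the environment.  The body of [EIter] sees the
   accumulator in register [t.+1] and the iteration index in [t.+2]. *)
Fixpoint ev t e (r : nat -> nat) : nat :=
  match e with
  | EVar i => r i
  | ECst n => n
  | ESuc e => (ev t e r).+1
  | EPair e1 e2 =>
    let v1 := ev t e1 r in cpair v1 (ev t.+1 e2 (upd r t v1))
  | EIter en e0 e1 =>
    let n := ev t en r in
    iteri n (fun i acc => ev t.+3 e1
               (upd (upd (upd r t (n - i.+1)) t.+1 acc) t.+2 i))
      (ev t.+1 e0 (upd r t n))
  end.

Fixpoint wf_expr t e :=
  match e with
  | EVar i => (i < t) && (i != 1)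
  | ECst n => true
  | ESuc e => wf_expr t e
  | EPair e1 e2 => wf_expr t e1 && wf_expr t.+1 e2
  | EIter en e0 e1 => [&& wf_expr t en, wf_expr t.+1 e0 & wf_expr t.+3 e1]
  end.

Fixpoint cexp t e :=
  match e with
  | EVar i => copy i t t.+1
  | ECst n => iter n (Seq (Incr t)) Skip
  | ESuc e => cexp t e ;; Incr t
  | EPair e1 e2 => cexp t e1 ;; cexp t.+1 e2 ;; pair_com t
  | EIter en e0 e1 =>
    cexp t en ;; cexp t.+1 e0 ;;
    Loop t (cexp t.+3 e1 ;; Loop t.+1 Skip ;; Loop t.+3 (Incr t.+1) ;; Incr t.+2) ;;
    Loop t.+2 Skip ;; Loop t.+1 (Incr t)
  end.

(** Registers from [t] on are scratch: they start at zero and all but [t] return to zero.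
    Subexpressions can therefore be evaluated in turn at increasing bases. *)
Lemma exec_cexp e t r : 1 < t -> r 1 = 0 -> wf_expr t e ->
    (forall i, t <= i -> r i = 0) ->
  exec (cexp t e) r (upd r t (ev t e r)).
Proof.
elim: e t r => [i|n|e IH|e1 IH1 e2 IH2|en IHn e0 IH0 e1 IH1] t r t1 r1 /=.
- move=> /andP[lti /eqP ni1] rt.
  have -> : upd r t (r i) = upd r t (r t + r i) by rewrite (rt t).
  by have rt1 := rt _ (leqnSn t); apply: exec_copy => //; lia.
- move=> _ rt; have -> : upd r t n = upd r t (r t + n) by rewrite (rt t).
  elim: n r r1 {rt} => [|n IH] r r1 /=.
    have -> : upd r t (r t + 0) = r by state_eq.
    exact: exec_skip.
  apply: exec_seq; first exact: exec_incr.
  set r' := upd _ t _.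
  have -> : upd r t (r t + n.+1) = upd r' t (r' t + n) by rewrite /r'; state_eq.
  by apply: IH; rewrite /r'; upd_cases.
- move=> we rt; apply: exec_seq; first by apply: IH.
  by apply: exec_incr_eq; state_eq.
- move=> /andP[w1 w2] rt; apply: exec_seq; first by apply: IH1.
  set r' := upd r t _.
  apply: exec_seq.
    apply: IH2 => // [||i lti]; first exact: ltnW.
      by rewrite /r'; upd_cases.
    by have := rt i; rewrite /r'; upd_cases.
  set v2 := ev _ e2 _; set v1 := ev t e1 r in r' v2 *.
  set r'' := upd r' _ _.
  have -> : upd r t (cpair v1 v2) = upd (upd r'' t (cpair (r'' t) (r'' t.+1))) t.+1 0.
    have -> : r'' t = v1 by rewrite /r'' /r' /upd; do ?case: eqP; lia.
    have -> : r'' t.+1 = v2 by rewrite /r'' /r' /upd; do ?case: eqP; lia.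
    have rt1 : r t.+1 = 0 by apply: rt.
    by rewrite /r'' /r'; state_eq.
  apply: exec_pair_com => //; first by rewrite /r'' /r'; upd_cases.
  move=> i lti; have := rt i; rewrite /r'' /r'; upd_cases.
- move=> /and3P[wn w0 w1] rt.
  have [rt1 rt2 rt3] : [/\ r t.+1 = 0, r t.+2 = 0 & r t.+3 = 0] by rewrite !rt //; lia.
  apply: exec_seq; first by apply: IHn.
  set n := ev t en r.
  apply: exec_seq.
    apply: IH0 => // [||i lti]; first exact: ltnW.
      by upd_cases.
    by have := rt i; upd_cases.
  set f := fun i acc => _; set a0 := ev t.+1 e0 _.
  apply: (exec_seq (r2 := upd (upd (upd r t 0) t.+1 (iteri n f a0)) t.+2 n)).
    apply: (@exec_loop _ _ (fun i =>
      upd (upd (upd r t (n - i)) t.+1 (iteri i f a0)) t.+2 i) n).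
    + by rewrite /=; state_eq.
    + by state_eq.
    + by move=> i _; upd_cases.
    + move=> i lti; set r' := upd _ t _; set acc := iteri i f a0 in r' *.
      have Er' : r' = upd (upd (upd r t (n - i.+1)) t.+1 acc) t.+2 i.
        by rewrite /r'; state_eq.
      apply: exec_seq.
        apply: IH1 => // [|j ltj]; rewrite Er'; first by upd_cases.
        by have := rt j; upd_cases.
      rewrite Er' /=.
      rewrite -/(f i acc).
      apply: exec_seq; first by apply: exec_clear; upd_cases.
      apply: exec_seq; first by apply: exec_move; try lia; upd_cases.
      by apply: exec_incr_eq; state_eq.
    + by move=> i lti; upd_cases.
  apply: exec_seq; first by apply: exec_clear; upd_cases.
  set r' := upd _ t.+2 0.
  have -> : upd r t (iteri n f a0) = upd (upd r' t (r' t + r' t.+1)) t.+1 0.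
    by rewrite /r'; state_eq.
  by apply: exec_move; rewrite /r'; try lia; upd_cases.
Qed.

(** * Vector machines *)

Definition halts_reg (p : seq instr) (o x y : nat) : Prop :=
  exists n, let s := iter n (cstep p) (cinit x) in size p <= s.1 /\ s.2 o = y.

Lemma iter_halted p n s : size p <= s.1 -> iter n (cstep p) s = s.
Proof.
by move=> hs; elim: n => //= n ->; case: s hs => pc r /=; rewrite leqNgt => /negbTE ->.
Qed.

Lemma iter_halted_le p n n' s : n <= n' -> size p <= (iter n (cstep p) s).1 ->
  iter n' (cstep p) s = iter n (cstep p) s.
Proof. by move=> le hs; rewrite -(subnK le) iterD iter_halted. Qed.

Lemma halts_reg_inj p o x y y' : halts_reg p o x y -> halts_reg p o x y' -> y = y'.
Proof.
move=> [n [hn <-]] [n' [hn' <-]].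
by case: (leqP n n') => [/iter_halted_le ->|/ltnW/iter_halted_le ->].
Qed.

(** Moving registers up by two turns the input register 0 of a program into register 2, where
    [cexp 2] leaves its value; the answer is then found in register 2 as well. *)
Definition shift_instr b i :=
  match i with INC k => INC k.+2 | DEC k j => DEC k.+2 (b + j) end.

Definition precompose e p :=
  let pre := compile 0 (cexp 2 e) in pre ++ map (shift_instr (size pre)) p.

Lemma shift_step pre p pc (r r' : nat -> nat) :
    (forall i, r' i.+2 = r i) ->
  exists r1', cstep (pre ++ map (shift_instr (size pre)) p) (size pre + pc, r') =
    (size pre + (cstep p (pc, r)).1, r1') /\
    forall i, r1' i.+2 = (cstep p (pc, r)).2 i.
Proof.
move=> Hr; rewrite /cstep size_cat size_map ltn_add2l.
case: ifP => [lt|_]; last by exists r'.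
rewrite nth_cat ltnNge leq_addr /= addKn (nth_map (INC 0)) //.
case: (nth _ p pc) => [k|k j] /=.
  by exists (upd r' k.+2 (r' k.+2).+1); split=> [|i]; rewrite ?addnS // /upd !eqSS !Hr.
rewrite Hr; case: (r k) => [|n]; first by exists r'.
by exists (upd r' k.+2 n); split=> [|i]; rewrite ?addnS // /upd !eqSS !Hr.
Qed.

Lemma shift_iter pre p n pc (r r' : nat -> nat) :
    (forall i, r' i.+2 = r i) ->
  exists r1', iter n (cstep (pre ++ map (shift_instr (size pre)) p)) (size pre + pc, r') =
    (size pre + (iter n (cstep p) (pc, r)).1, r1') /\
    forall i, r1' i.+2 = (iter n (cstep p) (pc, r)).2 i.
Proof.
move=> Hr; elim: n => [|n [r1 [IH1 IH2]]] /=; first by exists r'.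
rewrite IH1; case E: (iter n (cstep p) (pc, r)) IH2 => [pc1 r2] /= IH2.
exact: shift_step.
Qed.

Lemma precompose_halts e p x y : wf_expr 2 e ->
  halts_with p (ev 2 e (cinit x).2) y -> halts_reg (precompose e p) 2 x y.
Proof.
move=> we [n /= [Hn Hy]].
set pre := compile 0 (cexp 2 e).
have ex : exec (cexp 2 e) (cinit x).2 (upd (cinit x).2 2 (ev 2 e (cinit x).2)).
  by apply: exec_cexp => // i; case: i => [|[|i]].
have [n1 En1] := compileP ex [::] (map (shift_instr (size pre)) p).
set r' := upd _ _ _ in En1.
have Hr' i : r' i.+2 = (cinit (ev 2 e (cinit x).2)).2 i by case: i.
have [r1 [E1 E2]] := shift_iter pre p n 0 Hr'.
exists (n + n1); rewrite iterD /precompose -/pre.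
have -> : cinit x = (0, (cinit x).2) by [].
rewrite [iter n1 _ _]En1 /= add0n.
rewrite addn0 in E1.
rewrite -[csize _](size_compile 0) -/pre E1 /= size_cat size_map.
by rewrite leq_add2l; split; [exact: Hn|rewrite E2].
Qed.

Inductive vop := Up | Down | Keep.

Definition vapply o n := match o with Up => n.+1 | Down => n.-1 | Keep => n end.

(* A vector machine updates [vk] counters in parallel, each by -1, 0 or 1
   according to which counters are zero; counter 0 is its acceptance flag. *)
Record vmach := VM { vk : nat; vin : nat; vdelta : seq bool -> nat -> vop }.

Definition zeros k (v : nat -> nat) := [seq v i == 0 | i <- iota 0 k].

Definition vstep M v i := vapply (vdelta M (zeros (vk M) v) i) (v i).

Definition vinit M x i := if i == vin M then x else 0.

Definition vrun M x b := iter b (vstep M) (vinit M x).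

Definition vaccepts M x := exists b, 0 < vrun M x b 0.

Definition instr_reg i := match i with INC k => k | DEC k _ => k end.

(** * Simulation of counter machines by vector machines *)

Section Simulation.
Variables (p : seq instr) (o nr : nat).
Hypotheses (ltp : all (fun i => instr_reg i < nr) p) (lto : o < nr).

Let n := size p.

(* Counters 1..n hold the program counter (capped at n) in one-hot form, with
   all of them zero for program counter 0; register i is counter n.+1 + i. *)
Definition sim_pc (z : seq bool) := head 0 [seq q <- iota 1 n | ~~ nth true z q].

Definition sim_next z :=
  let pc := sim_pc z in
  if pc < n then
    match nth (INC 0) p pc with
    | INC _ => pc.+1
    | DEC k j => if nth true z (n.+1 + k) then minn j n else pc.+1
    end
  else pc.

Definition sim_delta z i :=
  let pc := sim_pc z in
  if i == 0 then if (pc == n) && nth true z (n.+1 + o) then Up else Keep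
  else if i <= n then
    let pc' := sim_next z in
    if pc == pc' then Keep
    else if i == pc' then Up else if i == pc then Down else Keep
  else if pc < n then
    match nth (INC 0) p pc with
    | INC k => if i == n.+1 + k then Up else Keep
    | DEC k _ => if i == n.+1 + k then Down else Keep
    end
  else Keep.

Definition sim_vm := VM (n.+1 + nr) n.+1 sim_delta.

Definition sim_rel (v : nat -> nat) (s : cstate) :=
  (forall q, 0 < q <= n -> v q = (q == minn s.1 n)) /\
  (forall i, i < nr -> v (n.+1 + i) = s.2 i).

Lemma nth_zeros k v i : i < k -> nth true (zeros k v) i = (v i == 0).
Proof. by move=> lti; rewrite (nth_map 0) ?size_iota // nth_iota. Qed.

Lemma sim_pcE v s : sim_rel v s -> sim_pc (zeros (n.+1 + nr) v) = minn s.1 n.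
Proof.
move=> [Hq _]; rewrite /sim_pc.
have -> : [seq q <- iota 1 n | ~~ nth true (zeros (n.+1 + nr) v) q] =
          [seq q <- iota 1 n | q == minn s.1 n].
  apply: eq_in_filter => q; rewrite mem_iota => Hqn.
  by rewrite nth_zeros; [rewrite Hq; [case: (q == _)|lia]|lia].
have [s0|s0] := posnP (minn s.1 n).
  rewrite s0 (@eq_in_filter _ _ pred0) ?filter_pred0 // => q.
  by rewrite mem_iota /=; lia.
have: minn s.1 n \in iota 1 n by rewrite mem_iota; lia.
by move=> Hin; rewrite filter_pred1_uniq ?iota_uniq.
Qed.

Lemma sim_step v s : sim_rel v s -> sim_rel (vstep sim_vm v) (cstep p s).
Proof.
move=> H; have Hpc := sim_pcE H; case: s H Hpc => pc r [Hq Hr] Hpc.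
rewrite /= in Hq Hr; rewrite [fst _]/= in Hpc.
have Hz k : k < nr -> nth true (zeros (n.+1 + nr) v) (n.+1 + k) = (r k == 0).
  by move=> ltk; rewrite nth_zeros ?Hr //; lia.
rewrite /vstep [vk _]/= [vdelta _]/= /sim_delta /sim_next Hpc.
move: (zeros _ v) Hz {Hpc} => z Hz.
have [ltpc|gepc] : pc < n \/ n <= pc by lia.
  have Emin : minn pc n = pc by lia.
  rewrite Emin ltpc in Hq *.
  have := all_nthP (INC 0) ltp pc ltpc.
  have cap : minn pc.+1 n = pc.+1 by lia.
  have -> : cstep p (pc, r) = match nth (INC 0) p pc with
    | INC k => (pc.+1, upd r k (r k).+1)
    | DEC k j => if r k is n.+1 then (pc.+1, upd r k n) else (j, r)
    end by rewrite /cstep ltpc.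
  case: (nth _ p pc) => [k|k j] /= ltk.
  - split=> [q Hqn|i lti]; rewrite /=.
      rewrite Hq // cap.
      rewrite ifF; last lia. rewrite ifT; last lia.
      rewrite ifF; last lia.
      by case: (q =P pc.+1) => ?; case: (q =P pc) => ? //=; lia.
    rewrite ifF; last lia.
    by rewrite eqn_add2l /upd; case: eqP => [->|_] /=; rewrite Hr.
  rewrite (Hz k ltk); case Erk: (r k) => [|m].
  - split=> [q Hqn|i lti]; rewrite /=.
      rewrite Hq //.
      rewrite ifF; last lia. rewrite ifT; last lia.
      case: (pc =P minn j n) => [->|nj] //=.
      by case: (q =P minn j n) => ?; case: (q =P pc) => ? //=; lia.
    rewrite ifF; last lia.
    by rewrite eqn_add2l; case: eqP => [->|_] /=; rewrite Hr // Erk.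
  - split=> [q Hqn|i lti]; rewrite /=.
      rewrite Hq // cap.
      rewrite ifF; last lia. rewrite ifT; last lia.
      rewrite ifF; last lia.
      by case: (q =P pc.+1) => ?; case: (q =P pc) => ? //=; lia.
    rewrite ifF; last lia.
    by rewrite eqn_add2l /upd; case: eqP => [->|_] /=; rewrite Hr // Erk.
have Emin : minn pc n = n by lia.
rewrite Emin ltnn eqxx in Hq *.
have -> : cstep p (pc, r) = (pc, r) by rewrite /cstep ltnNge gepc.
split=> [q Hqn|i lti]; rewrite /=.
  rewrite ifF; last lia. rewrite ifT; last lia.
  by rewrite Hq // Emin.
rewrite ifF; last lia.
by rewrite /= Hr.
Qed.

Lemma sim_run x b : sim_rel (vrun sim_vm x b) (iter b (cstep p) (cinit x)).
Proof.
elim: b => [|b IH] /=; last exact: sim_step.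
split=> [q Hq|i lti] /=; rewrite /vinit /=.
  by rewrite min0n; case: eqP => [|_]; case: eqP; lia.
by rewrite -[X in _ == X]addn0 eqn_add2l.
Qed.

Lemma sim_accepts x : vaccepts sim_vm x <-> halts_reg p o x 0.
Proof.
(* The flag never decreases, and it grows exactly at the steps where the program has halted with 0
   in register [o]. *)
have flag b : vstep sim_vm (vrun sim_vm x b) 0 = vrun sim_vm x b 0 +
    ((n <= (iter b (cstep p) (cinit x)).1) && ((iter b (cstep p) (cinit x)).2 o == 0)).
  have H := sim_run x b; have Hpc := sim_pcE H; case: H => _ /(_ o lto) Hr.
  rewrite /vstep [vk _]/= [vdelta _]/= /sim_delta eqxx Hpc nth_zeros; last lia.
  rewrite Hr (_ : (minn _ n == n) = (n <= (iter b (cstep p) (cinit x)).1)); last lia.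
  by case: (_ && _); rewrite /= ?addn1 ?addn0.
split=> [[b]|[b /= [H1 H2]]].
  elim: b => [|b IH]; first by rewrite /vrun /= /vinit /=.
  rewrite /vrun iterS -/(vrun _ _ _) flag.
  case E: (_ && _); last by rewrite addn0.
  by move=> _; exists b; move/andP: E => [? /eqP].
exists b.+1; rewrite /vrun iterS -/(vrun _ _ _) flag H1 H2 eqxx addn1 //.
Qed.

End Simulation.

Lemma vm_of_counter p o : exists M, 0 < vk M /\
  forall x, vaccepts M x <-> halts_reg p o x 0.
Proof.
pose nr := (maxn o (foldr maxn 0 (map instr_reg p))).+1.
exists (sim_vm p o nr); split=> // x; apply: sim_accepts => //; last by rewrite ltnS leq_maxl.
have : all (fun i => instr_reg i <= foldr maxn 0 (map instr_reg p)) p.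
  elim: p {nr} => //= i q IH; rewrite leq_maxl /=.
  by apply: sub_all IH => j /leq_trans -> //; rewrite leq_maxr.
by apply: sub_all => j; rewrite ltnS => /leq_trans -> //; rewrite leq_maxr.
Qed.

(** * Intended graphs and their rigidity *)

(* Vertices of the intended graphs.  The [VK]s form a clique.  The [VA]s (time)
   and the [VB]s (height) are two paths: the heights adjacent to [VA t] are those
   up to the value [colval y t] of one counter, the columns being grouped in
   blocks of [vk M] consecutive ones.  The [VC]s are labels: 0 and 1 mark the ends
   of the time line, 2-4 the residue of the time modulo 3, 5 the first column of
   each block, 6 and 7 the heights up to and above the input, and 8 and 9 stand
   past the far and the near end of the height line.  [VA 0] is adjacent to
   everything, so that no spoke is void and the rung is not either. *)
Inductive vtx := VK of nat | VC of nat | VA of nat | VB of nat.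

Definition vtx_code u :=
  match u with VK i => (0, i) | VC i => (1, i) | VA i => (2, i) | VB i => (3, i) end.
Definition vtx_decode (c : nat * nat) :=
  match c with
  | (0, i) => VK i | (1, i) => VC i | (2, i) => VA i | (_, i) => VB i
  end.
Lemma vtx_codeK : cancel vtx_code vtx_decode. Proof. by case. Qed.
HB.instance Definition _ := Equality.copy vtx (can_type vtx_codeK).

Definition path_adj i j := (i.+1 == j) || (j.+1 == i).

Section Intended.
Variable M : vmach.
Let k := vk M.

(** Columns showing counters start at time 1, since [VA 0] is the full column. *)
Definition colval y t := vrun M y (t.-1 %/ k) (t.-1 %% k).

Definition adj_CA T c t :=
  match c with
  | 0 => t == 0
  | 1 => t == T
  | 2 => (t == 0) || (t %% 3 == 0)
  | 3 => (t == 0) || (t %% 3 == 1)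
  | 4 => (t == 0) || (t %% 3 == 2)
  | 5 => (t == 0) || (k %| t.-1)
  | 9 => true
  | _ => false
  end.

Definition adj_CB y L c j :=
  match c with
  | 6 => j <= y
  | 7 => y < j
  | 8 => j.+1 == L
  | 9 => j == 1
  | _ => false
  end.

Definition adj_AB y t j := (t == 0) || (j <= colval y t).

Definition iadj y T L u v :=
  match u, v with
  | VK i, VK j => i != j
  | VK i, VC c | VC c, VK i => i <= c
  | VC c, VA t | VA t, VC c => adj_CA T c t
  | VC c, VB j | VB j, VC c => adj_CB y L c j
  | VA t, VA s => path_adj t s
  | VA t, VB j | VB j, VA t => adj_AB y t j
  | VB i, VB j => path_adj i j
  | _, _ => false
  end.

Definition valid T L u :=
  match u with
  | VK i => i < 12
  | VC c => c < 10
  | VA t => t <= T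
  | VB j => 0 < j < L
  end.

(** Column [(b * k).+1] shows counter 0 after [b] steps, so the time line ends on a raised flag. *)
Definition intended y T L :=
  [/\ y.+1 < L,
      exists2 b, T = (b * k).+1 & 0 < vrun M y b 0
    & forall t, 0 < t <= T -> colval y t < L].

Lemma iadj_sym y T L : symmetric (iadj y T L).
Proof. by case=> i [] j //=; rewrite /path_adj 1?orbC // eq_sym. Qed.

Lemma iadj_irr y T L : irreflexive (iadj y T L).
Proof. by case=> i //=; rewrite /path_adj ?eqxx //; lia. Qed.

(* A proper colouring with 5 colours outside [VK]: a clique has at most 5
   vertices outside [VK]. *)
Definition colour u :=
  match u with VK i => 5 + i | VC _ => 4 | VA t => t %% 2 | VB j => 2 + j %% 2 end.

Lemma colour_proper y T L u v : iadj y T L u v -> colour u <> colour v.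
Proof. by case: u v => i [] j //=; rewrite /path_adj; lia. Qed.

Definition core := map VK (iota 0 12) ++ map VC (iota 0 10).

Lemma core_K i : i < 12 -> VK i \in core.
Proof. by move=> lti; rewrite mem_cat map_f // mem_iota. Qed.

Lemma core_C c : c < 10 -> VC c \in core.
Proof. by move=> lti; rewrite mem_cat orbC map_f // mem_iota. Qed.

Lemma count_leq_iota c : c < 10 -> count (fun i => i <= c) (iota 0 12) = c.+1.
Proof.
have /allP/(_ c) : all (fun c => count (fun i => i <= c) (iota 0 12) == c.+1) (iota 0 10).
  by [].
by rewrite mem_iota => H /H/eqP.
Qed.

Section Rigidity.
Variables (y T L : nat) (W : pred vtx) (phi : vtx -> vtx) (adj : rel vtx).
Hypothesis coreW : forall u, u \in core -> W u.
Hypothesis phi_valid : forall u, W u -> valid T L (phi u).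
Hypothesis phi_inj : forall u v, W u -> W v -> phi u = phi v -> u = v.
Hypothesis phi_adj : forall u v, W u -> W v -> iadj y T L (phi u) (phi v) = adj u v.
Hypothesis adjKK : forall i j, i < 12 -> j < 12 -> adj (VK i) (VK j) = (i != j).
Hypothesis adjCK : forall c i, c < 10 -> i < 12 -> adj (VC c) (VK i) = (i <= c).

Let WK i : i < 12 -> W (VK i). Proof. by move/core_K/coreW. Qed.
Let WC c : c < 10 -> W (VC c). Proof. by move/core_C/coreW. Qed.

Let adj_phiK i j : i < 12 -> j < 12 -> i <> j ->
  iadj y T L (phi (VK i)) (phi (VK j)).
Proof. by move=> lti ltj /eqP nij; rewrite phi_adj ?WK // adjKK. Qed.

Definition isK u := if u is VK _ then true else false.

(** Twelve pairwise adjacent images have distinct colours, and only five colours occur outside the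
    [VK]s. *)
Lemma phi_someK : exists2 i, i < 12 & isK (phi (VK i)).
Proof.
pose s := iota 0 12.
have [/hasP[i]|/hasPn noK] := boolP (has (fun i => isK (phi (VK i))) s).
  by rewrite mem_iota => lti iK; exists i.
suff : size [seq colour (phi (VK i)) | i <- s] <= size (iota 0 5) by [].
apply: uniq_leq_size.
  rewrite map_inj_in_uniq ?iota_uniq // => i j; rewrite !mem_iota => lti ltj E.
  by apply/eqP; apply: contraT => /eqP nij; case: (colour_proper (adj_phiK lti ltj nij)).
move=> c /mapP[i /noK + ->]; rewrite mem_iota.
by case: (phi (VK i)) => //= j _; lia.
Qed.

(** A neighbour of a [VK] is a [VK] or a [VC]. Were one image [VC c], the other eleven would be
    neighbours of it; the [VC]s being independent, they would be among the at most ten vertices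
    [VK a] with [a <= c]. *)
Lemma phi_K i : i < 12 -> isK (phi (VK i)).
Proof.
have [i0 lti0 i0K] := phi_someK.
have notAB j : j < 12 -> isK (phi (VK j)) \/ exists c, phi (VK j) = VC c.
  move=> ltj; have [->|nj] := eqVneq j i0; first by left.
  move/eqP: nj => /(adj_phiK ltj lti0).
  by case: (phi (VK i0)) i0K (phi (VK j)) => // a _ [] //= b _; [left|right; exists b].
move=> lti; have [//|[c Ec]] := notAB i lti.
have ltc : c < 10 by have := phi_valid (WK lti); rewrite Ec.
have others j : j < 12 -> j <> i -> exists2 a, phi (VK j) = VK a & a <= c.
  move=> ltj nji; have := adj_phiK ltj lti nji; rewrite Ec.
  have [|[c' ->]] := notAB j ltj; last by [].
  by case: (phi (VK j)) => //= a _ le; exists a.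
pose s := [seq j <- iota 0 12 | j != i].
have ss : size s = 11.
  have /allP/(_ i) : all (fun i => size [seq j <- iota 0 12 | j != i] == 11) (iota 0 12).
    by [].
  by rewrite mem_iota => /(_ lti)/eqP.
suff : size [seq colour (phi (VK j)) | j <- s] <= size (iota 5 10).
  by rewrite size_map ss.
apply: uniq_leq_size.
  rewrite map_inj_in_uniq ?filter_uniq ?iota_uniq // => a b.
  rewrite !mem_filter !mem_iota => /andP[_ lta] /andP[_ ltb] E.
  by apply/eqP; apply: contraT => /eqP nab; case: (colour_proper (adj_phiK lta ltb nab)).
move=> z /mapP[j]; rewrite mem_filter mem_iota => /andP[/eqP nji ltj] ->.
have [a -> le] := others j ltj nji; rewrite mem_iota /=; lia.
Qed.

Definition idx u := match u with VK i | VC i | VA i | VB i => i end.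

Let sigma i := idx (phi (VK i)).

Lemma phi_sigma i : i < 12 -> phi (VK i) = VK (sigma i).
Proof. by move/phi_K; rewrite /sigma; case: (phi _). Qed.

Lemma sigma_perm : perm_eq (map sigma (iota 0 12)) (iota 0 12).
Proof.
have u : uniq (map sigma (iota 0 12)).
  rewrite map_inj_in_uniq ?iota_uniq // => a b; rewrite !mem_iota => lta ltb E.
  suff [] : VK a = VK b by [].
  by apply: phi_inj; rewrite ?WK // !phi_sigma // E.
apply: uniq_perm; rewrite ?iota_uniq //.
apply: (uniq_min_size u _ _).2 => //.
move=> z /mapP[i]; rewrite !mem_iota => lti ->.
by have := phi_valid (WK lti); rewrite phi_sigma.
Qed.

Lemma sigma_onto a : a < 12 -> exists2 i, i < 12 & phi (VK i) = VK a.
Proof.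
move=> lta; have : a \in map sigma (iota 0 12) by rewrite (perm_mem sigma_perm) mem_iota.
by case/mapP=> i; rewrite mem_iota => lti ->; exists i => //; rewrite phi_sigma.
Qed.

Lemma phi_notK u a : W u -> ~~ isK u -> phi u <> VK a.
Proof.
move=> Wu nK E; have lta : a < 12 by have := phi_valid Wu; rewrite E.
have [i lti Ei] := sigma_onto lta.
have Eu : u = VK i by apply: phi_inj; rewrite ?WK // E Ei.
by rewrite Eu in nK.
Qed.

(** [phi] permutes the [VK]s, so it preserves the number of neighbours among them. This number is
    [c.+1] for [VC c] and 0 on both lines. *)
Lemma phi_C c : c < 10 -> phi (VC c) = VC c.
Proof.
move=> ltc.
have degc : count (fun a => iadj y T L (phi (VC c)) (VK a)) (iota 0 12) = c.+1.
  rewrite -(seq.permP sigma_perm) count_map.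
  rewrite (@eq_in_count _ _ (fun i => i <= c)); last first.
    move=> i; rewrite mem_iota => lti /=.
    by rewrite -phi_sigma // phi_adj ?WK ?WC // adjCK.
  exact: count_leq_iota.
have := phi_notK (WC ltc) isT.
case E: (phi (VC c)) => [a|c'|t|j] nK; first by case: (nK a).
- congr VC; rewrite E in degc.
  have ltc' : c' < 10 by have := phi_valid (WC ltc); rewrite E.
  by move: degc; rewrite [count _ _](count_leq_iota ltc') => -[].
- by rewrite E in degc.
- by rewrite E in degc.
Qed.

Lemma phi_line u : W u -> ~~ isK u -> (forall i, i < 12 -> adj u (VK i) = false) ->
  exists a, phi u = VA a \/ phi u = VB a.
Proof.
move=> Wu nK noK; have [i lti Ei] := sigma_onto (isT : 0 < 12).
have := noK i lti; rewrite -phi_adj ?WK // Ei; have := phi_notK Wu nK.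
by case E: (phi u) => [a|c|t|j] //= nE _; [case: (nE a)|exists t; left|exists j; right].
Qed.

(** Every [VB] of an intended graph carries label 6 or 7, according to its position relative to the
    input. *)
Lemma phi_A t : W (VA t) -> (forall i, i < 12 -> adj (VA t) (VK i) = false) ->
    adj (VA t) (VC 6) = false -> adj (VA t) (VC 7) = false ->
  exists2 s, s <= T & phi (VA t) = VA s.
Proof.
move=> Wt noK; rewrite -!phi_adj ?WC // !phi_C //.
have [a [E|E]] := phi_line Wt isT noK; last by rewrite E /=; lia.
by exists a => //; have := phi_valid Wt; rewrite E.
Qed.

(** Every [VA] of an intended graph carries one of the residue labels 2, 3, 4. *)
Lemma phi_B j : W (VB j) -> (forall i, i < 12 -> adj (VB j) (VK i) = false) ->
    adj (VB j) (VC 2) = false -> adj (VB j) (VC 3) = false ->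
    adj (VB j) (VC 4) = false ->
  exists2 s, 0 < s < L & phi (VB j) = VB s.
Proof.
move=> Wt noK; rewrite -!phi_adj ?WC // !phi_C //.
have [a [E|E]] := phi_line Wt isT noK; first by rewrite E /=; lia.
by exists a => //; have := phi_valid Wt; rewrite E.
Qed.

End Rigidity.
End Intended.

(** * Local agreement with intended graphs forces the computation *)

(* The residues modulo 3 exclude reading the window backwards. *)
Lemma shift_window t0 t (alpha : nat -> nat) :
    t0 <= t -> t0 = 0 \/ t0.+2 <= t ->
    (forall s, t0 <= s < t -> path_adj (alpha s) (alpha s.+1)) ->
    (forall s s', t0 <= s <= t -> t0 <= s' <= t -> alpha s = alpha s' -> s = s') ->
    (forall s, t0 <= s < t -> s = 0 <-> alpha s = 0) ->
    (forall s, t0 <= s < t -> 0 < s -> alpha s %% 3 = s %% 3) ->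
  forall s, t0 <= s <= t -> alpha s + t0 = alpha t0 + s.
Proof.
move=> le ht adj inj z m3.
have step s : t0 <= s -> s.+1 < t -> alpha s.+1 = (alpha s).+1.
  move=> h1 h2; have a := adj s ltac:(lia); have zs := z s ltac:(lia).
  have zs1 := z s.+1 ltac:(lia); have m1 := m3 s.+1 ltac:(lia) isT.
  have m0 := m3 s ltac:(lia); move: a; rewrite /path_adj; case: (posnP s) => s0.
    by subst s; lia.
  by have := m0 s0; lia.
(* No residue is known at [t] itself; injectivity excludes a step back onto [alpha] of [t - 2]. *)
have last s : t0 <= s -> s.+1 = t -> alpha s.+1 = (alpha s).+1.
  move=> h1 h2; have a := adj s ltac:(lia); move: a; rewrite /path_adj.
  case: s h1 h2 => [|s] h1 h2; first by have := z 0 ltac:(lia); lia.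
  have [E|lt] : t0 = s.+1 \/ t0 <= s by lia.
    by have := z s.+1 ltac:(lia); lia.
  have := step s lt ltac:(lia); have i := inj s s.+2 ltac:(lia) ltac:(lia).
  by move=> E; case/orP=> /eqP // E'; exfalso; lia.
elim=> [|s IH] hs; first by have -> : t0 = 0 by lia.
have [E|lt] : t0 = s.+1 \/ t0 <= s by lia.
  by rewrite E addnC.
have [E|lt2] : s.+1 = t \/ s.+1 < t by lia.
  by rewrite last //; have := IH ltac:(lia); lia.
by rewrite step //; have := IH ltac:(lia); lia.
Qed.

(** A change by at most 1 moves the threshold [j] to a neighbouring height. If the heights are read
    upside down, monotonicity in both readings forces the three comparisons to coincide, so the
    reversal is harmless. *)
Lemma vapply_window o j j' jm jp r r' :
    0 < j -> 0 < j' ->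
    (jm = j'.-1 /\ jp = j'.+1) \/ (jm = j'.+1 /\ jp = j'.-1) ->
    (j.-1 <= r) = (jm <= r') -> (j <= r) = (j' <= r') -> (j.+1 <= r) = (jp <= r') ->
  (j' <= vapply o r') = (j <= vapply o r).
Proof. by case: o => /= *; lia. Qed.

Section Induction.
Variable M : vmach.
Let k := vk M.
Hypothesis k_gt0 : 0 < k.


Lemma val_step y t : k < t ->
  colval M y t =
    vapply (vdelta M (zeros k (vrun M y (t.-1 %/ k).-1)) (t.-1 %% k)) (colval M y (t - k)).
Proof.
move=> lt; rewrite /colval -/k.
have -> : (t - k).-1 = t.-1 - k by lia.
have dm := divn_eq t.-1 k.
have ge1 : 0 < t.-1 %/ k by rewrite divn_gt0 //; lia.
have E : t.-1 - k = (t.-1 %/ k).-1 * k + t.-1 %% k by nia.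
have -> : (t.-1 - k) %/ k = (t.-1 %/ k).-1.
  by rewrite E divnMDl // [_ %% k %/ k]divn_small ?ltn_pmod // addn0.
have -> : (t.-1 - k) %% k = t.-1 %% k by rewrite E modnMDl modn_mod.
by rewrite -{1}(prednK ge1).
Qed.

Lemma zeros_val y b : zeros k (vrun M y b) = [seq colval M y (b * k + i).+1 == 0 | i <- iota 0 k].
Proof.
apply/eq_in_map => i; rewrite mem_iota => lti.
by rewrite /colval /= -/k divnMDl // modnMDl divn_small ?modn_small ?addn0.
Qed.

Variables (x T L : nat) (adj : rel vtx).

(** The height line with its two ends: [VC 9], adjacent to all times, acts as height 0, and [VC 8],
    adjacent to none, as a height above every value. *)
Definition Bx L i := if i == 0 then VC 9 else if i == L then VC 8 else VB i.

Lemma BxE l i : 0 < i < l -> Bx l i = VB i.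
Proof. by move=> ir; rewrite /Bx; case: eqP => [|_]; [lia|case: eqP => [|_ //]; lia]. Qed.

Hypothesis adjKK : forall i j, i < 12 -> j < 12 -> adj (VK i) (VK j) = (i != j).
Hypothesis adjCK : forall c i, c < 10 -> i < 12 -> adj (VC c) (VK i) = (i <= c).
Hypothesis adjAK : forall t i, t <= T -> i < 12 -> adj (VA t) (VK i) = false.
Hypothesis adjBK : forall j i, 0 < j < L -> i < 12 -> adj (VB j) (VK i) = false.
Hypothesis adjAA : forall t s, t <= T -> s <= T -> adj (VA t) (VA s) = path_adj t s.
Hypothesis adjBB : forall i j, 0 < i < L -> 0 < j < L -> adj (VB i) (VB j) = path_adj i j.
(** The labels left out have spokes to the time line, whose edges a realization chooses freely. *)
Hypothesis adjAC : forall t c, t <= T -> c \in [:: 0; 1; 6; 7; 8] ->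
  adj (VA t) (VC c) = adj_CA M T c t.
Hypothesis adjBC : forall j c, 0 < j < L -> c \in [:: 2; 3; 4; 6; 8; 9] ->
  adj (VB j) (VC c) = adj_CB x L c j.
Hypothesis ltxL : x.+1 < L.
Hypothesis windows : forall W, all (valid T L) W -> size W <= 2 * k + 29 ->
  exists y T' L' phi, [/\ intended M y T' L', forall u, u \in W -> valid T' L' (phi u),
    forall u v, u \in W -> v \in W -> phi u = phi v -> u = v
  & forall u v, u \in W -> v \in W -> iadj M y T' L' (phi u) (phi v) = adj u v].

(* A window of [adj] ending at time [t] and centred at height [j], read in an
   intended graph at times [alpha] and, possibly upside down, heights [beta]. *)
Definition agreement t j y T' L' (alpha beta : nat -> nat) :=
  let t0 := t - (2 * k).+2 in
  [/\ intended M y T' L',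
      forall s, t0 <= s <= t ->
        alpha s <= T' /\ forall c, c < 10 -> adj (VA s) (VC c) = adj_CA M T' c (alpha s),
      (forall s s', t0 <= s <= t -> t0 <= s' <= t ->
        path_adj (alpha s) (alpha s') = path_adj s s' /\ (alpha s = alpha s' -> s = s'))
    & [/\ beta 1 = 1, 0 < beta j < L',
      (beta j.-1 = (beta j).-1 /\ beta j.+1 = (beta j).+1) \/
      (beta j.-1 = (beta j).+1 /\ beta j.+1 = (beta j).-1),
      (j.+1 == L) = ((beta j).+1 == L') /\ (j <= x) = (beta j <= y)
    & forall s i, t0 <= s <= t -> i \in [:: 1; j.-1; j; j.+1] -> 0 < alpha s ->
        adj (VA s) (Bx L i) = (beta i <= colval M y (alpha s)) ] ].

Lemma agreement_ex t j : t <= T -> 0 < j < L ->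
  exists y T' L' alpha beta, agreement t j y T' L' alpha beta.
Proof.
move=> leT jL; set t0 := t - (2 * k).+2.
pose J := [:: 1; j.-1; j; j.+1].
(* At most 22 core vertices, 2k + 3 times and 4 heights, hence the bound 2k + 29. *)
pose W := core ++ map VA (iota t0 (t - t0).+1) ++ map (Bx L) J.
have JL i : i \in J -> i <= L by rewrite !inE; lia.
have vBx i : i \in J -> valid T L (Bx L i).
  by move/JL => iL; rewrite /Bx; case: eqP => // ?; case: eqP => //= ?; lia.
have [||y [T' [L' [phi [intended' vphi iphi aphi]]]]] := windows (W := W).
- rewrite !all_cat; apply/and3P; split=> //.
    by apply/allP=> u /mapP[s]; rewrite mem_iota => sr -> /=; lia.
  by apply/allP=> u /mapP[i iJ ->]; apply: vBx.
- by rewrite !size_cat !size_map !size_iota /=; lia.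
have cW u : u \in core -> u \in W by move=> uc; rewrite mem_cat uc.
have AW s : t0 <= s <= t -> VA s \in W.
  by move=> sr; rewrite !mem_cat map_f ?orbT // mem_iota; lia.
have BW i : i \in J -> Bx L i \in W by move=> iJ; rewrite !mem_cat (map_f (Bx L) iJ) !orbT.
have CW c : c < 10 -> VC c \in W by move/core_C/cW.
have phiC c : c < 10 -> phi (VC c) = VC c.
  exact: (phi_C (W := mem W) cW vphi iphi aphi adjKK adjCK).
have phiA s : t0 <= s <= t -> exists2 s', s' <= T' & phi (VA s) = VA s'.
  move=> sr; apply: (phi_A (W := mem W) cW vphi iphi aphi adjKK adjCK) => //.
  - exact: AW.
  - by move=> i; apply: adjAK; lia.
  - by rewrite adjAC //; lia.
  - by rewrite adjAC //; lia.
have phiB i : i \in J -> 0 < i < L -> exists2 i', 0 < i' < L' & phi (VB i) = VB i'.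
  move=> iJ ir; apply: (phi_B (W := mem W) cW vphi iphi aphi adjKK adjCK) => //.
  - by have := BW i iJ; rewrite BxE.
  - by move=> i'; apply: adjBK.
  - by rewrite adjBC.
  - by rewrite adjBC.
  - by rewrite adjBC.
have [ltyL' _ valL'] := intended'.
pose alpha s := idx (phi (VA s)).
(* The ends of the height line are labels, which [phi] fixes, so height 0 goes to 0 and [L] to
   [L']. *)
pose beta i := if i == 0 then 0 else if i == L then L' else idx (phi (VB i)).
have b0 : beta 0 = 0 by [].
have bL : beta L = L' by rewrite /beta eqxx; case: eqP => //; lia.
have EA s : t0 <= s <= t -> phi (VA s) = VA (alpha s) /\ alpha s <= T'.
  by move/phiA=> [s' le E]; rewrite /alpha E.
have EB i : i \in J -> 0 < i < L -> phi (VB i) = VB (beta i) /\ 0 < beta i < L'.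
  move=> iJ ir; have [i' le E] := phiB i iJ ir.
  by rewrite /beta E; case: eqP => [|_]; [lia|case: eqP => [|_ //]; lia].
have EBx i : i \in J -> phi (Bx L i) = Bx L' (beta i) /\ beta i <= L'.
  move=> iJ; have iL := JL i iJ; rewrite /Bx.
  have [i0|i0] := eqVneq i 0; first by rewrite phiC // /beta i0.
  have [iL'|iL'] := eqVneq i L.
    rewrite phiC // /beta (negbTE i0) iL' eqxx leqnn eqxx; case: eqP => //; lia.
  have [-> br] := EB i iJ ltac:(lia).
  by case: eqP => [|_]; [lia|case: eqP => [|_]; [lia|split=> //; lia]].
have jJ : j \in J by rewrite !inE eqxx !orbT.
have oJ : 1 \in J by rewrite !inE eqxx.
have mJ : j.-1 \in J by rewrite !inE eqxx !orbT.
have pJ : j.+1 \in J by rewrite !inE eqxx !orbT.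
have BW' i : i \in J -> 0 < i < L -> VB i \in W by move=> iJ ir; rewrite -(BxE ir) BW.
have [Ej brj] := EB j jJ jL.
have Cj c : c \in [:: 6; 8; 9] -> adj_CB y L' c (beta j) = adj_CB x L c j.
  move=> cin; have c10 : c < 10 by move: cin; rewrite !inE; lia.
  have <- : adj (VB j) (VC c) = adj_CB x L c j.
    by apply: adjBC => //; move: cin; rewrite !inE; lia.
  by rewrite -aphi ?BW' ?CW // Ej phiC.
have nbr i : i \in J -> path_adj i j -> path_adj (beta i) (beta j).
  move=> iJ; have iL := JL i iJ.
  have [i0|i0] := eqVneq i 0.
    by have := Cj 9 isT; rewrite i0 b0 /path_adj /=; lia.
  have [iL'|iL'] := eqVneq i L.
    by have := Cj 8 isT; rewrite iL' bL /path_adj /=; lia.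
  have [Ei bri] := EB i iJ ltac:(lia).
  rewrite -adjBB; [|lia|lia].
  by rewrite -aphi ?BW' //; [rewrite Ei Ej|lia].
have binj i i' : i \in J -> i' \in J -> beta i = beta i' -> i = i'.
  move=> iJ i'J E.
  have B1 : Bx L i = Bx L i' by apply: iphi; rewrite ?BW // !(EBx _ _).1 // E.
  have := JL i iJ; have := JL i' i'J; move: B1; rewrite /Bx.
  by case: (i =P 0) => ?; case: (i' =P 0) => ?; case: (i =P L) => ?;
    case: (i' =P L) => ? // EB1; try lia; case: EB1 => *; lia.
exists y, T', L', alpha, beta; split=> //.
- move=> s sr; have [Es le] := EA s sr; split=> // c c10.
  by rewrite -aphi ?AW ?CW // Es phiC.
- move=> s s' sr sr'; have [Es le] := EA s sr; have [Es' le'] := EA s' sr'; split.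
    have <- : adj (VA s) (VA s') = path_adj s s' by apply: adjAA; lia.
    by rewrite -aphi ?AW // Es Es'.
  by move=> E; suff [] : VA s = VA s' by []; apply: iphi; rewrite ?AW // Es Es' E.
- split=> //.
  + have o1 : 0 < 1 < L by lia.
    have [E1 b1] := EB 1 oJ o1.
    have: adj (VB 1) (VC 9) by rewrite adjBC.
    by rewrite -aphi ?BW' ?CW // E1 phiC //= => /eqP.
  + have := nbr _ mJ; have := nbr _ pJ; have := binj _ _ mJ pJ; rewrite /path_adj; lia.
  + by split; [have := Cj 8 isT|have := Cj 6 isT].
  + move=> s i sr iJ a0; have [Es le] := EA s sr; have [Ei bi] := EBx i iJ.
    rewrite -aphi ?AW ?BW // Es Ei /Bx.
    have vL := valL' (alpha s) ltac:(lia).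
    case: eqP => [->//|_]; case: eqP => [->|_] /=; first by lia.
    by rewrite /adj_AB; lia.
Qed.

(** The induction hypothesis along time: the freely chosen edges at [VA t] are those of the run on
    [x]. *)
Definition tracks t :=
  [/\ forall c, c < 3 -> adj (VA t) (VC (2 + c)) = (t == 0) || (t %% 3 == c),
      adj (VA t) (VC 5) = (t == 0) || (k %| t.-1)
    & 0 < t -> colval M x t < L /\
        forall j, 0 < j < L -> adj (VA t) (VB j) = (j <= colval M x t)].

Lemma adjA9 t : t <= T -> adj (VA t) (VC 9).
Proof.
move=> leT; have [|y [T' [L' [al [be [_ /(_ t) H _ _]]]]]] := agreement_ex (j := 1) leT; first lia.
by have [|_ ->] := H; first lia.
Qed.

Lemma tracks_Bx s i : s <= T -> tracks s -> 0 < s -> i <= L ->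
  adj (VA s) (Bx L i) = (i <= colval M x s).
Proof.
move=> sT [_ _ H] /H[vL Hj] iL; rewrite /Bx.
case: eqP => [->|i0]; first exact: adjA9.
case: eqP => [->|iL']; first by rewrite adjAC //=; lia.
by apply: Hj; lia.
Qed.

(** Before [t] the residue labels are known from [tracks], so [shift_window] gives a constant time
    shift. It vanishes when the window reaches time 0, and label 5 makes it a multiple of [k]. *)
Lemma agreement_shift t j y T' L' al be : 0 < t <= T ->
    (forall s, s < t -> tracks s) -> agreement t j y T' L' al be ->
  let t0 := t - (2 * k).+2 in
  [/\ forall s, t0 <= s <= t -> al s + (t - s) = al t,
      forall s, t0 <= s <= t -> 0 < s -> 0 < al s,
      t0 = 0 -> al t = t,
      al t %% 3 = t %% 3
    & (al t).-1 %% k = t.-1 %% k].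
Proof.
move=> ht IH [_ Hc Hp _] t0.
have pi s c : t0 <= s < t -> c < 3 ->
    (al s == 0) || (al s %% 3 == c) = (s == 0) || (s %% 3 == c).
  move=> sr c3; have [E _ _] := IH s ltac:(lia); rewrite -(E c c3).
  have [_ {}E] := Hc s ltac:(lia); rewrite E; last lia.
  by case: c c3 => [|[|[|]]].
have z s : t0 <= s < t -> s = 0 <-> al s = 0.
  move=> sr; have := pi s 0 sr isT; have := pi s 1 sr isT; have := pi s 2 sr isT; lia.
have m3 s : t0 <= s < t -> 0 < s -> al s %% 3 = s %% 3.
  move=> sr s0; have := z s sr; have := pi s (s %% 3) sr (ltn_mod s 3).
  by rewrite eqxx orbT => /orP[/eqP ->|/eqP //]; lia.
have sh : forall s, t0 <= s <= t -> al s + t0 = al t0 + s.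
  apply: shift_window z m3; try by lia.
  - by move=> s sr; have [-> _] := Hp s s.+1 ltac:(lia) ltac:(lia); rewrite /path_adj eqxx.
  - by move=> s s' sr sr' E; have [_] := Hp s s' sr sr'; apply.
have sht s : t0 <= s <= t -> al s + (t - s) = al t.
  by move=> sr; have := sh s sr; have := sh t ltac:(lia); lia.
have al0 s : t0 <= s <= t -> 0 < s -> 0 < al s.
  move=> sr s0; have [lt|->] : s < t \/ s = t by lia.
    by have := z s ltac:(lia); lia.
  by have := sht t.-1 ltac:(lia); lia.
have alt : t0 = 0 -> al t = t.
  by move=> t00; have := z 0 ltac:(lia); have := sht 0 ltac:(lia); lia.
split=> //.
  have [t1|t1] : t = 1 \/ 1 < t by lia.
    by have := sht 0 ltac:(lia); have := z 0 ltac:(lia) ; have := sht t ltac:(lia); lia.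
  by have := m3 t.-1 ltac:(lia) ltac:(lia); have := sht t.-1 ltac:(lia); lia.
have [t00|t00] := posnP t0; first by rewrite alt.
(* The last first-of-block column before [t]: its label 5 is already known and is read at [al s]. *)
pose s := (t.-2 %/ k * k).+1.
have dm := divn_eq t.-2 k; have lm : t.-2 %% k < k by rewrite ltn_mod.
have sr : t0 <= s < t by rewrite /s; lia.
have [_ Hm _] := IH s ltac:(lia).
have [_ /(_ 5 isT)] := Hc s ltac:(lia).
rewrite Hm /= dvdn_mull //= -/k => /esym.
have as0 := al0 s ltac:(lia) isT.
rewrite (_ : al s == 0 = false) /=; last lia.
move=> dv; have E := sht s ltac:(lia).
have -> : (al t).-1 = (al s).-1 + (t - s) by clear -E as0; lia.
have s0 : 0 < s by [].
have -> : t.-1 = s.-1 + (t - s) by clear -sr s0; lia.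
by rewrite -modnDml (eqP dv) /s /= modnMDl add0n.
Qed.

(** In the first block the shift is 0. The input [y] of the intended graph may differ from [x], but
    label 6 makes the comparisons with height [j] agree. *)
Lemma agreement_initial t j y T' L' al be : 0 < t <= T -> t <= k -> 0 < j < L ->
    (forall s, s < t -> tracks s) -> agreement t j y T' L' al be ->
  adj (VA t) (VB j) = (j <= colval M x t).
Proof.
move=> ht tk jL IH ag.
have [sht al0 alt m3 mk] := agreement_shift ht IH ag.
have Et : al t = t by apply: alt; lia.
case: ag => _ _ _ [b1 bj _ [_ bx] Hb].
have := Hb t j; rewrite Et.
have -> : Bx L j = VB j by rewrite BxE.
move=> ->; [|lia|by rewrite !inE eqxx !orbT|lia].
have tk' : t.-1 < k by lia.
rewrite /colval -/k divn_small // modn_small // /vrun /= /vinit.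
by case: eqP => _; [rewrite bx|lia].
Qed.

(** The window contains the whole preceding block, already known to be right. It determines the
    operation applied to the counter of column [t], and [vapply_window] transfers the result at
    height [j]. *)
Lemma agreement_later t j y T' L' al be : 0 < t <= T -> k < t -> 0 < j < L ->
    (forall s, s < t -> tracks s) -> agreement t j y T' L' al be ->
  [/\ adj (VA t) (VB j) = (j <= colval M x t)
    & j.+1 = L -> colval M x t < L].
Proof.
move=> ht tk jL IH ag.
have [sht al0 alt m3 mk] := agreement_shift ht IH ag.
case: ag => [[_ _ vL'] Hc _ [b1 bj bjm [bL bx] Hb]].
have [b Eb] : exists b, b = t.-1 %/ k by eexists.
have [i0 Ei] : exists i0, i0 = t.-1 %% k by eexists.
have [b' Eb'] : exists b', b' = (al t).-1 %/ k by eexists.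
have li0 : i0 < k by rewrite Ei ltn_mod.
have b0 : 0 < b by rewrite Eb divn_gt0 //; clear -tk; lia.
have [P EP] : exists P, P = b.-1 * k by eexists.
have dt : t.-1 = P + k + i0.
  by rewrite [LHS](divn_eq _ k) -Eb -Ei -{1}(prednK b0) mulSn EP [k + _]addnC.
have [Q EQ] : exists Q, Q = b' * k by eexists.
have dt' : (al t).-1 = Q + i0 by rewrite [LHS](divn_eq _ k) mk -Eb' -Ei EQ.
have vx := val_step x tk; rewrite -Eb -Ei in vx.
have vy := @val_step y (al t); rewrite mk -Eb' -Ei in vy.
have at0 := al0 t ltac:(clear -ht; lia) ltac:(clear -ht; lia).
have ltP : (P + k + i0).+1 = t by clear -ht dt; lia.
have ltQ : (Q + i0).+1 = al t by clear -at0 dt'; lia.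
clear Eb Ei Eb' mk dt dt' m3 alt.
pose S i := (P + i).+1.
have ltS i : i < k -> t - (2 * k).+2 <= S i < t by rewrite /S; clear -ltP li0; lia.
(* Otherwise the start [S 0] of the preceding block, which lies in the window, would be read at a
   time that is not positive. *)
have b'0 : 0 < b'.
  case: (posnP b') => // b'0; rewrite b'0 in EQ.
  have S0 := ltS 0 k_gt0; have := sht (S 0) ltac:(clear -S0; lia).
  have := al0 (S 0) ltac:(clear -S0; lia) isT.
  by rewrite /S; clear -ltP ltQ EQ k_gt0; lia.
have [P' EP'] : exists P', P' = b'.-1 * k by eexists.
have b'k : Q = P' + k by rewrite EQ EP' -{1}(prednK b'0) mulSn addnC.
have alS i : i < k -> al (S i) = (P' + i).+1.
  move=> lti; have Si := ltS i lti; have := sht (S i) ltac:(clear -Si; lia).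
  by rewrite /S; clear -ltP ltQ b'k li0 lti; lia.
have tk_ : t - k = S i0 by rewrite /S; clear -ltP; lia.
have atk : al t - k = (P' + i0).+1 by clear -ltQ b'k; lia.
have {}vy := vy ltac:(clear -ltQ b'k; lia).
have same i s : i \in [:: 1; j.-1; j; j.+1] -> s < k ->
    (i <= colval M x (S s)) = (be i <= colval M y (al (S s))).
  move=> iJ lts; have Sr := ltS s lts.
  rewrite -tracks_Bx; [|clear -Sr ht; lia|apply: IH; clear -Sr; lia|by []|].
    by rewrite Hb //; [clear -Sr; lia|rewrite alS].
  by move: iJ; rewrite !inE; clear -jL; lia.
(* Zero tests are comparisons with height 1, which [be] fixes. *)
have zE : zeros k (vrun M x b.-1) = zeros k (vrun M y b'.-1).
  rewrite !zeros_val; apply/eq_in_map => i; rewrite mem_iota => lti.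
  have := same 1 i isT lti; rewrite b1 alS // /S EP EP'; clear; lia.
rewrite tk_ zE in vx; rewrite atk -alS // in vy.
have j1 := same j.-1 i0 _ li0; have j2 := same j i0 _ li0; have j3 := same j.+1 i0 _ li0.
rewrite !inE !eqxx !orbT in j1 j2 j3.
have key := vapply_window (vdelta M (zeros k (vrun M y b'.-1)) i0) (j := j) (j' := be j)
  ltac:(clear -jL; lia) ltac:(clear -bj; lia) bjm (j1 isT) (j2 isT) (j3 isT).
rewrite -vx -vy in key; rewrite -key.
have -> : VB j = Bx L j by rewrite BxE.
split=> [|jL'].
  by rewrite Hb //; [clear -ht; lia|rewrite !inE eqxx !orbT].
have tr : t - (2 * k).+2 <= t <= t by clear; lia.
have [alT _] := Hc t tr; have vL := vL' (al t) ltac:(clear -alT at0; lia).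
have vS : colval M x (S i0) < L.
  by have Si := ltS i0 li0; have [_ _ []] := IH (S i0) ltac:(clear -Si; lia).
(* A value escaping past the top [j] of the line would come from [Up] applied to [j]; the same
   operation would then bring the intended graph to [L'], against [vL]. *)
move: vx vy (j2 isT) key bL bj; clear -vS vL jL'.
by case: (vdelta _ _ _) => /=; lia.
Qed.

Lemma all_tracks t : t <= T -> tracks t.
Proof.
elim/ltn_ind: t => t IH tT.
have {}IH s : s < t -> tracks s by move=> st; apply: IH => //; lia.
have [t0|t0] := posnP t.
  have [|y [T' [L' [al [be [_ /(_ t) H _ _]]]]]] := agreement_ex (j := 1) tT; first lia.
  have [|_ Hc] := H; first lia.
  (* Label 0 marks time 0 and is fixed by the host, hence starts the induction. *)
  have az : al t = 0.
    by have := Hc 0 isT; rewrite adjAC // /adj_CA; lia.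
  split=> [c c3||]; last by rewrite t0.
    by rewrite Hc; [case: c c3 => [|[|[|]]] //= _; rewrite az t0|lia].
  by rewrite Hc // /adj_CA az t0.
have ht : 0 < t <= T by lia.
split.
- move=> c c3.
  have [|y [T' [L' [al [be ag]]]]] := agreement_ex (j := 1) tT; first lia.
  have [sht al0 alt m3 mk] := agreement_shift ht IH ag.
  case: ag => _ /(_ t) H _ _; have [|_ Hc] := H; first lia.
  have at0 := al0 t ltac:(lia) t0.
  have e1 : (t == 0) = false by lia.
  have e2 : (al t == 0) = false by lia.
  rewrite Hc; last lia.
  by rewrite e1; case: c c3 => [|[|[|]]] //= _; rewrite e2 /= m3.
- have [|y [T' [L' [al [be ag]]]]] := agreement_ex (j := 1) tT; first lia.
  have [sht al0 alt m3 mk] := agreement_shift ht IH ag.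
  case: ag => _ /(_ t) H _ _; have [|_ Hc] := H; first lia.
  have at0 := al0 t ltac:(lia) t0.
  have e1 : (t == 0) = false by lia.
  have e2 : (al t == 0) = false by lia.
  by rewrite Hc // /= e1 e2 /= /dvdn -/k mk.
move=> _; have [tk|tk] := leqP t k.
  split.
    have tk' : t.-1 < k by lia.
    by rewrite /colval -/k divn_small // modn_small // /vrun /= /vinit; case: eqP; lia.
  move=> j jL; have [y [T' [L' [al [be ag]]]]] := agreement_ex tT jL.
  exact: agreement_initial ag.
split.
  have [|y [T' [L' [al [be ag]]]]] := agreement_ex (j := L.-1) tT; first lia.
  by have [|_] := agreement_later ht tk _ IH ag; [lia|apply; lia].
move=> j jL; have [y [T' [L' [al [be ag]]]]] := agreement_ex tT jL.
by have [] := agreement_later ht tk jL IH ag.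
Qed.

(** Label 1 sends [T] to the end of an intended graph, where the flag is raised. Label 5 shows that
    column [T] also holds counter 0, and height 1 that its value is positive. *)
Lemma windows_accept : vaccepts M x.
Proof.
have trT := all_tracks (leqnn T).
have [|y [T' [L' [al [be ag]]]]] := agreement_ex (j := 1) (leqnn T); first lia.
case: ag => [[_ [b ET' vb] _] /(_ T) H _ [b1 _ _ _ Hb]]; have [|_ Hc] := H; first lia.
have aT : al T = T'.
  by have := Hc 1 isT; rewrite adjAC // /adj_CA eqxx => /esym/eqP.
have T0 : 0 < T.
  rewrite lt0n; apply/eqP => T0.
  have := Hc 0 isT; rewrite adjAC // /adj_CA T0 eqxx -{1}T0 aT ET' //.
have [_ H5 /(_ T0)[vL Hj]] := trT.
have T0' : (T == 0) = false by lia.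
have := Hc 5 isT; rewrite H5 aT /adj_CA -/k ET' /= dvdn_mull // T0' /= => /dvdnP[b' Eb'].
exists b'.
have := Hb T 1; rewrite aT b1 tracks_Bx //; last lia.
rewrite /colval -/k Eb' mulnK // modnMl ET' /= mulnK // modnMl vb.
by move=> -> //; lia.
Qed.

End Induction.

(** * The host pathograph *)

Definition core_edges : seq (nat * nat) :=
  [seq p <- [seq (i, j) | i <- iota 0 12, j <- iota 0 22]
    | (p.1 < p.2) && ((p.2 < 12) || (p.1 <= p.2 - 12))].

Definition core_spokes : seq (nat * nat) :=
  [:: (14, 0); (15, 0); (16, 0); (17, 0); (21, 0); (19, 1)].

Definition input_edges E x : seq (nat * nat) :=
  iteri x (fun i E => (21 + i, 22 + i) :: (18, 22 + i) :: E) E.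

Definition input_spokes S x : seq (nat * nat) :=
  iteri x (fun i S => (22 + i, 0) :: S) S.

(** Urpath 0 is the time line between [VC 0] and [VC 1]. Urpath 1 is the height line above the
    input, from [VC 8] to the last input vertex, which is [VC 9] (number 21) when [x] is 0. *)
Definition host x := PG (22 + x) 2 (input_edges core_edges x)
  (input_spokes core_spokes x) [:: (0, 1)] [:: (12, 13); (20, 21 + x)].

Lemma mem_core_edges a b : ((a, b) \in core_edges) =
  [&& a < b, a < 12, b < 22 & (b < 12) || (a <= b - 12)].
Proof.
rewrite mem_filter [fst _]/= [snd _]/=.
have -> : ((a, b) \in [seq (i, j) | i <- iota 0 12, j <- iota 0 22]) = (a < 12) && (b < 22).
  apply/allpairsP/andP => [[[i j]]|[lta ltb]].
    by rewrite !mem_iota => -[lti ltj [-> ->]].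
  by exists (a, b); rewrite !mem_iota.
by lia.
Qed.

Lemma mem_input_edges E x a b : ((a, b) \in input_edges E x) =
  ((a, b) \in E) || (22 <= b < 22 + x) && ((a == b.-1) || (a == 18)).
Proof.
elim: x => [|x IH]; first by rewrite /= [X in _ || X](_ : _ = false) ?orbF //; lia.
rewrite /input_edges /= -/(input_edges E x) !inE IH !xpair_eqE.
by case: (_ \in E) => /=; lia.
Qed.

Lemma mem_input_spokes S x v u : ((v, u) \in input_spokes S x) =
  ((v, u) \in S) || (22 <= v < 22 + x) && (u == 0).
Proof.
elim: x => [|x IH]; first by rewrite /= [X in _ || X](_ : _ = false) ?orbF //; lia.
rewrite /input_spokes /= -/(input_spokes S x) !inE IH !xpair_eqE.
by case: (_ \in S) => /=; lia.
Qed.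

Lemma host_edgeE x a b : ((a, b) \in pE (host x)) =
  [&& a < b, a < 12, b < 22 & (b < 12) || (a <= b - 12)] ||
  (22 <= b < 22 + x) && ((a == b.-1) || (a == 18)).
Proof. by rewrite mem_input_edges mem_core_edges. Qed.

Lemma host_spokeE x v u : ((v, u) \in pS (host x)) =
  (((v \in [:: 14; 15; 16; 17]) || (21 <= v < 22 + x)) && (u == 0)) ||
  ((v == 19) && (u == 1)).
Proof. by rewrite mem_input_spokes !inE !xpair_eqE; lia. Qed.

Lemma host_wf x : wf_pg (host x).
Proof.
rewrite /wf_pg; apply/and5P; split.
- by apply/allP => -[a b]; rewrite host_edgeE /=; lia.
- elim: x => [|x IH]; first by rewrite filter_uniq // allpairs_uniq ?iota_uniq // => -[? ?] [].
  rewrite /= -/(input_edges core_edges x) inE !mem_input_edges !mem_core_edges xpair_eqE.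
  by rewrite [uniq _]IH; lia.
- by apply/allP => -[v u]; rewrite host_spokeE /= !inE; lia.
- elim: x => [//|x IH].
  rewrite /= -/(input_spokes core_spokes x) mem_input_spokes [uniq _]IH.
  by rewrite !inE !xpair_eqE; lia.
apply/and5P; split=> //=; first by rewrite andbT; lia.
by rewrite andbT -/(pE (host x)) !host_edgeE; lia.
Qed.

Lemma adj_CBE y L c j : adj_CB y L c j = [|| (c == 6) && (j <= y), (c == 7) && (y < j),
  (c == 8) && (j.+1 == L) | (c == 9) && (j == 1)].
Proof. by do 10! [case: c => [|c] /=; rewrite ?orbF //]. Qed.

Definition host_vtx v := if v < 12 then VK v else if v < 22 then VC (v - 12) else VB (v - 21).

(** The host vertices stand for the core and the heights up to [x], whose adjacency depends on
    neither [M] nor [T]; [x.+1 < L] keeps them away from [VC 8]. *)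
Lemma host_edge_iadj M x T L v w : v < 22 + x -> w < 22 + x -> x.+1 < L ->
  pedge (host x) v w = iadj M x T L (host_vtx v) (host_vtx w).
Proof.
move=> ltv ltw ltL; rewrite /pedge !host_edgeE /host_vtx.
by case: (ltnP v 12) => ?; case: (ltnP w 12) => ?; try (case: (ltnP v 22) => ?);
  try (case: (ltnP w 22) => ?); rewrite /= ?adj_CBE /path_adj; lia.
Qed.

(** * Realization of an accepting computation *)

Definition embeds M (F : pgraph) := exists y T L f,
  [/\ intended M y T L, forall a, a < nv F -> valid T L (f a),
      forall a b, a < nv F -> b < nv F -> f a = f b -> a = b
    & forall a b, a < nv F -> b < nv F -> iadj M y T L (f a) (f b) = pedge F a b].

(* Internal vertex [i] of urpath 1 is counted from its first endpoint, which is
   the far end of the line of [VB]s. *)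
Definition real_vtx x (m : 'I_(nu (host x)) -> nat) L (u : rvert m) : vtx :=
  match u with
  | inl v => host_vtx v
  | inr (existT u i) => if (u : nat) == 0 then VA i else VB (L.-1 - i)
  end.

Section Build.
Variables (M : vmach) (x T L : nat).
Hypothesis ltxL : x.+1 < L.

Definition urlen (u : 'I_(nu (host x))) := if (u : nat) == 0 then T.+1 else L - x.+1.

Lemma urlen_gt0 u : 0 < urlen u.
Proof. by rewrite /urlen; case: eqP => _; lia. Qed.

Lemma real_vtx_valid (u : rvert urlen) : valid T L (real_vtx L u).
Proof.
case: u => [[v]|[[[|[|//]] ltu] [i]]] /=; rewrite /urlen /=; try lia.
by rewrite /host_vtx; case: ifP => ?; [|case: ifP => ?]; rewrite /=; lia.
Qed.

Lemma real_vtx_inj : injective (@real_vtx x urlen L).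
Proof.
move=> [[v ltv]|[[[|[|//]] ltu] [i lti]]] [[w ltw]|[[[|[|//]] ltu'] [j ltj]]] //=.
- rewrite /host_vtx => E; congr inl; apply: val_inj => /=; move: E.
  by case: (ltnP v 12) => ?; case: (ltnP w 12) => ?; try (case: (ltnP v 22) => ?);
    try (case: (ltnP w 22) => ?); case=> //; lia.
- by rewrite /host_vtx; case: ifP => ?; [|case: ifP => ?].
- have ltv' : v < 22 + x := ltv; have ltj' : j < L - x.+1 := ltj.
  by rewrite /host_vtx; case: ifP => ?; [|case: ifP => ?] => // -[]; lia.
- by rewrite /host_vtx; case: ifP => ?; [|case: ifP => ?].
- have Eu : ltu = ltu' by apply: bool_irrelevance.
  by subst ltu' => -[E]; congr inr; congr existT; apply: val_inj.
- have ltw' : w < 22 + x := ltw; have lti' : i < L - x.+1 := lti.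
  by rewrite /host_vtx; case: ifP => ?; [|case: ifP => ?] => // -[]; lia.
- have Eu : ltu = ltu' by apply: bool_irrelevance.
  have [lti' ltj'] : i < L - x.+1 /\ j < L - x.+1 by split; [exact: lti|exact: ltj].
  by subst ltu' => -[E]; congr inr; congr existT; apply: val_inj => /=; lia.
Qed.

Lemma build_real :
  is_realization (fun u v => iadj M x T L (@real_vtx x urlen L u) (real_vtx L v)).
Proof.
split; first exact: urlen_gt0.
split; first by move=> u v; rewrite iadj_sym.
split; first by move=> u; rewrite iadj_irr.
split; first by move=> v w; rewrite (host_edge_iadj M T _ _ ltxL) //; apply: ltn_ord.
split.
  move=> [v ltv] [[|[|//]] ltu] [i lti]; rewrite /pathend /ppi /=.
    by case/orP=> /andP[/eqP -> /eqP ->] /=.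
  have lti' : i < L - x.+1 := lti.
  rewrite /urlen /=.
  case/orP=> /andP[/eqP -> /eqP ->] /=; first by lia.
  have -> : L.-1 - (L - x.+1).-1 = x.+1 by lia.
  have -> : host_vtx (21 + x) = if x == 0 then VC 9 else VB x.
    rewrite /host_vtx (_ : 21 + x < 12 = false) // (_ : 21 + x < 22 = (x == 0)); last lia.
    by case: eqP => [->|_]; last by congr VB; lia.
  by case: eqP => [->|_] //=; rewrite /path_adj eqxx.
split.
  move=> [v ltv] [[|[|//]] ltu] [i lti]; have ltv' : v < 22 + x := ltv;
    rewrite host_spokeE /pathend /ppi /urlen /= !inE /host_vtx.
    have lti' : i < T.+1 := lti.
    case: (ltnP v 12) => ? //; case: (ltnP v 22) => ? /=; last by lia.
    have [c Ec] : exists c, c = v - 12 by eexists.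
    rewrite -Ec; have -> : v = c + 12 by lia.
    have c10 : c < 10 by lia.
    by move: c10 {Ec}; do 10! [case: c => [|c] /=; first by lia].
  have lti' : i < L - x.+1 := lti.
  case: (ltnP v 12) => ? //; case: (ltnP v 22) => ? /=; rewrite ?adj_CBE /path_adj; lia.
split.
  move=> [v ltv] u; rewrite host_spokeE !inE => Hs.
  (* The first internal vertex serves every spoke: it is the full column [VA 0] on urpath 0, and the
     top height, above the input and so labelled 7, on urpath 1. *)
  exists (Ordinal (urlen_gt0 u)); move: Hs; rewrite /pathend /ppi /= /host_vtx.
  have ltv' : v < 22 + x := ltv.
  case: u => [[|[|//]] ltu] /=.
    move=> Hs; apply/andP; split; first by lia.
    rewrite ifF; last lia; case: ifP => ? //=.
    have [c Ec] : exists c, c = v - 12 by eexists.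
    rewrite -Ec; have : c \in [:: 2; 3; 4; 5; 9] by rewrite !inE; lia.
    by rewrite !inE; case/or4P => [/eqP->|/eqP->|/eqP->|/orP[]/eqP->].
  by move=> Hs; (have -> /= : v = 19 by lia); lia.
split.
  move=> [[|[|//]] ltu] [i lti] [j ltj] //=.
  have [lti' ltj'] : i < L - x.+1 /\ j < L - x.+1 by split; [exact: lti|exact: ltj].
  by rewrite /path_adj; lia.
split.
  move=> [[|[|//]] ltu] [[|[|//]] ltu'] i j // /eqP nu _; case: nu; exact: val_inj.
move=> u u'; rewrite inE xpair_eqE => /andP[/eqP E0 /eqP E1].
exists (Ordinal (urlen_gt0 u)), (Ordinal (urlen_gt0 u')).
by rewrite /= E0 E1.
Qed.

End Build.

Lemma accept_free M x Fs : vaccepts M x ->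
    (forall F, Stdlib.Lists.List.In F Fs -> ~ embeds M F) ->
  has_free_realization (host x) Fs.
Proof.
move=> [b vb] HF.
(* [T] is the column of the raised flag; [L] exceeds all values shown as well as [x.+1]. *)
pose T := (b * vk M).+1; pose L := (\max_(t < T.+1) colval M x t) + x + 2.
have ltxL : x.+1 < L by rewrite /L; lia.
have intended' : intended M x T L.
  split=> //; first by exists b.
  move=> t /andP[t0 tT]; have tT' : t < T.+1 by [].
  have := @leq_bigmax _ (fun t : 'I_T.+1 => colval M x t) (Ordinal tT'); rewrite /L /=; lia.
exists (@urlen x T L), (fun u v => iadj M x T L (@real_vtx x (@urlen x T L) L u) (real_vtx L v)).
split; first exact: build_real.
move=> F /HF nE [m [adjF [HR [f [finj fadj]]]]]; apply: nE.
have H0 : forall a, a < nv F -> exists v : 'I_(nv F), (v : nat) = a.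
  by move=> a lta; exists (Ordinal lta).
pose g a := if insub a is Some v then real_vtx L (f (inl v)) else VK 0.
have gE (v : 'I_(nv F)) : g v = real_vtx L (f (inl v)) by rewrite /g valK.
exists x, T, L, g; split=> //.
- by move=> a /H0[v <-]; rewrite gE; apply: real_vtx_valid.
- move=> a a' /H0[v <-] /H0[w <-]; rewrite !gE.
  by move/(real_vtx_inj ltxL)/finj => [->].
- move=> a a' /H0[v <-] /H0[w <-]; rewrite !gE -fadj.
  by have [_ [_ [_ [-> _]]]] := HR.
Qed.

(** * Forbidden graphs *)

Notation In := Stdlib.Lists.List.In.

Lemma In_map (A : eqType) B (f : A -> B) x s : x \in s -> In (f x) (map f s).
Proof.
by elim: s => //= y s IH; rewrite inE => /orP[/eqP ->|/IH]; [left|right].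
Qed.

Lemma In_cat A (x : A) s1 s2 : In x (s1 ++ s2) <-> In x s1 \/ In x s2.
Proof. by elim: s1 => [|y s IH] /=; [|rewrite IH]; tauto. Qed.

Lemma In_flatten (A : eqType) B (f : A -> seq B) x y s :
  x \in s -> In y (f x) -> In y (flatten (map f s)).
Proof.
elim: s => //= z s IH; rewrite inE => /orP[/eqP <-|xs] fy; apply/In_cat; first by left.
by right; apply: IH.
Qed.

Lemma In_filter A (p : pred A) x s : In x (filter p s) <-> In x s /\ p x.
Proof.
elim: s => [|y s IH] /=; first by split=> // -[].
case: ifP => py /=; rewrite IH; split.
- by case=> [<-|[]]; tauto.
- by tauto.
- by tauto.
- by case=> [[E|//] px]; rewrite E px in py.
Qed.

Fixpoint sublists A (s : seq A) :=
  if s is x :: s' then sublists s' ++ map (cons x) (sublists s') else [:: [::]].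

Lemma filter_sublists (A : eqType) (p : pred A) s : filter p s \in sublists s.
Proof.
elim: s => //= x s IH; rewrite mem_cat; case: ifP => _; last by rewrite IH.
by rewrite map_f ?orbT.
Qed.

Definition pairs n := [seq p <- [seq (a, b) | a <- iota 0 n, b <- iota 0 n] | p.1 < p.2].

Definition graph_of n E := PG n 0 E [::] [::] [::].

Definition graphs N :=
  flatten [seq map (graph_of n) (sublists (pairs n)) | n <- iota 0 N.+1].

Lemma graphs_filter N n p : n <= N -> In (graph_of n (filter p (pairs n))) (graphs N).
Proof.
move=> le; apply: (@In_flatten _ _ _ n); first by rewrite mem_iota.
by apply: In_map; apply: filter_sublists.
Qed.

Lemma mem_pairs n a b : ((a, b) \in pairs n) = (a < b < n).
Proof.
rewrite mem_filter /=.
have -> : ((a, b) \in [seq (i, j) | i <- iota 0 n, j <- iota 0 n]) = (a < n) && (b < n).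
  apply/allpairsP/andP => [[[i j]]|[lta ltb]].
    by rewrite !mem_iota => -[lti ltj [-> ->]].
  by exists (a, b); rewrite !mem_iota.
by lia.
Qed.

Lemma uniq_pairs n : uniq (pairs n).
Proof. by rewrite filter_uniq // allpairs_uniq ?iota_uniq // => -[? ?] []. Qed.

Lemma graph_of_wf n p : wf_pg (graph_of n (filter p (pairs n))).
Proof.
rewrite /wf_pg /= filter_uniq ?uniq_pairs // !andbT.
by apply/allP => -[a b]; rewrite mem_filter mem_pairs /=; lia.
Qed.

Definition embedsb M F := if excluded_middle_informative (embeds M F) then true else false.

Lemma embedsP M F : reflect (embeds M F) (embedsb M F).
Proof. by rewrite /embedsb; case: excluded_middle_informative => h; constructor. Qed.

(* All small graphs missing from every intended graph: nothing requires this
   list to be computable, as its code is the input of the diagonal program. *)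
Definition forbidden M := [seq F <- graphs (2 * vk M + 29) |
  [&& wf_pg F, nu F == 0 & ~~ embedsb M F]].

Lemma host_vtxK i : i < 12 -> host_vtx i = VK i.
Proof. by move=> lti; rewrite /host_vtx lti. Qed.

Lemma host_vtxC c : c < 10 -> host_vtx (12 + c) = VC c.
Proof. by do 10! [case: c => [//|c]]. Qed.

Lemma host_vtxB j : 0 < j -> host_vtx (21 + j) = VB j.
Proof. by case: j => // j _; rewrite /host_vtx /=; congr VB; lia. Qed.

(** * Reading a computation off a free realization *)

Section Extract.
Variables (M : vmach) (x : nat) (m : 'I_(nu (host x)) -> nat) (adj : rel (rvert m)).
Hypothesis k_gt0 : 0 < vk M.
Hypothesis real : is_realization adj.

Let u0 : 'I_(nu (host x)) := @Ordinal 2 0 isT.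
Let u1 : 'I_(nu (host x)) := @Ordinal 2 1 isT.
Let T := (m u0).-1.
Let m1 := m u1.
Let L := x + m1 + 1.

Definition hv v : rvert m := inl (@inord (21 + x) v).

Definition iv (u : 'I_(nu (host x))) i : rvert m :=
  if insub i is Some o then @ivert _ m u o else hv 0.

(** A section of [real_vtx]: heights up to [x] are host vertices, the others are internal to urpath
    1, which is numbered from its far end. *)
Definition hvtx u : rvert m :=
  match u with
  | VK i => hv i
  | VC c => hv (12 + c)
  | VA t => iv u0 t
  | VB j => if j <= x then hv (21 + j) else iv u1 (x + m1 - j)
  end.

Lemma ivE u i (lti : i < m u) : iv u i = ivert (Ordinal lti).
Proof. by rewrite /iv insubT. Qed.

Lemma m_gt0 u : 0 < m u. Proof. by case: real. Qed.

Lemma adj_sym u v : adj u v = adj v u.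
Proof. by case: real => _ [H _]; apply: H. Qed.

Lemma adj_hv v w : v < 22 + x -> w < 22 + x -> adj (hv v) (hv w) = pedge (host x) v w.
Proof. by move=> ltv ltw; case: real => _ [_ [_ [-> _]]]; rewrite !inordK. Qed.

Lemma adj_hviv v (u : 'I_(nu (host x))) i : v < 22 + x -> i < m u ->
    (v, u : nat) \notin pS (host x) ->
  adj (hv v) (iv u i) =
    (v == (ppi (host x) u).1) && (i == 0) || (v == (ppi (host x) u).2) && (i == (m u).-1).
Proof.
move=> ltv lti nS; case: real => _ [_ [_ [_ [Hp [Hs _]]]]].
have Ev : nat_of_ord (@inord (21 + x) v) = v by rewrite inordK.
rewrite (ivE lti).
transitivity (@pathend (host x) m (@inord (21 + x) v) u (Ordinal lti)).
  apply/idP/idP => [ad|]; last exact: Hp.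
  apply: contraNT nS => np; have := Hs _ _ _ np ad; by rewrite Ev.
by rewrite /pathend Ev.
Qed.

Lemma adj_iv u i j : i < m u -> j < m u -> adj (iv u i) (iv u j) = path_adj i j.
Proof.
move=> lti ltj; case: real => _ [_ [_ [_ [_ [_ [_ [H _]]]]]]].
by rewrite !ivE H.
Qed.

Lemma ltxL : x.+1 < L.
Proof. by have := m_gt0 u1; rewrite -/m1 /L; lia. Qed.

Lemma ltT t : t <= T -> t < m u0.
Proof. by have := m_gt0 u0; rewrite /T; lia. Qed.

Lemma ltB j : 0 < j < L -> x < j -> x + m1 - j < m u1.
Proof. by rewrite -/m1 /L; lia. Qed.

Lemma hvtxK u : valid T L u -> real_vtx L (hvtx u) = u.
Proof.
have hvE v : v < 22 + x -> real_vtx L (hv v) = host_vtx v.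
  by move=> ltv; rewrite /= inordK.
case: u => [i|c|t|j] h; rewrite [valid _ _ _]/= in h; rewrite /hvtx.
- by rewrite hvE ?host_vtxK //; lia.
- by rewrite hvE ?host_vtxC //; lia.
- by rewrite (ivE (ltT h)).
case: ifP => jx; first by rewrite hvE ?host_vtxB //; lia.
have xj : x < j by lia.
by rewrite (ivE (ltB h xj)) /=; congr VB; move: h; rewrite /L; lia.
Qed.

Let adjG u v := adj (hvtx u) (hvtx v).

Lemma extract_accept : (forall F, In F (forbidden M) -> ~ contains adj F) -> vaccepts M x.
Proof.
move=> free; have xL := ltxL.
have vv v w : v < 22 + x -> w < 22 + x ->
    adj (hv v) (hv w) = iadj M x T L (host_vtx v) (host_vtx w).
  by move=> ltv ltw; rewrite adj_hv // (host_edge_iadj M T _ _ xL).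
apply: (@windows_accept M k_gt0 x T L adjG) => //; rewrite /adjG /=.
- by move=> i j lti ltj; rewrite vv ?host_vtxK //; lia.
- by move=> c i ltc lti; rewrite vv ?(host_vtxK lti) ?host_vtxC //; lia.
- move=> t i tT lti; rewrite adj_sym adj_hviv ?ltT //; try lia.
    by rewrite /ppi /=; lia.
  by rewrite host_spokeE !inE; lia.
- move=> j i jr lti; case: ifP => jx.
    by rewrite vv ?(host_vtxK lti) ?host_vtxB //; lia.
  rewrite adj_sym adj_hviv ?ltB //; try lia.
    by rewrite /ppi /=; lia.
  by rewrite host_spokeE !inE; lia.
- by move=> t s tT sT; rewrite adj_iv ?ltT.
- have mixed i j : 0 < i < L -> 0 < j < L -> i <= x -> x < j ->
      adj (hv (21 + i)) (iv u1 (x + m1 - j)) = path_adj i j.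
    move=> ir jr ix xj; rewrite adj_hviv ?ltB //; try lia.
      by rewrite /ppi /= -/m1 /path_adj; move: jr; rewrite /L; lia.
    by rewrite host_spokeE !inE /=; lia.
  move=> i j ir jr; case: (leqP i x) => ix; case: (leqP j x) => jx.
  + by rewrite vv ?host_vtxB //; lia.
  + exact: mixed.
  + by rewrite adj_sym mixed // /path_adj orbC.
  + by rewrite adj_iv ?ltB // /path_adj; move: ir jr; rewrite /L; lia.
- move=> t c tT cin; rewrite adj_sym adj_hviv ?ltT //.
  + by move: cin; rewrite !inE /ppi /= => /or4P[|||/orP[]] /eqP ->; rewrite //= -/T; lia.
  + by move: cin; rewrite !inE; lia.
  + by move: cin; rewrite host_spokeE !inE /=; lia.
- move=> j c jr cin; have c10 : c < 10 by move: cin; rewrite !inE; lia.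
  case: ifP => jx.
    by rewrite vv ?(host_vtxC c10) ?host_vtxB //; lia.
  rewrite adj_sym adj_hviv ?ltB //; try lia.
    rewrite adj_CBE /ppi /= -/m1; move: cin jr; rewrite !inE /L; lia.
  by move: cin; rewrite host_spokeE !inE /=; lia.
(* The graph [F] induced on the window is small and contained in a free realization, so it is not
   forbidden and embeds in an intended graph. *)
move=> W vW sW; pose W' := undup W; pose n := size W'; pose d := VK 0.
pose F := graph_of n [seq p <- pairs n | adjG (nth d W' p.1) (nth d W' p.2)].
have irr u : adj u u = false by case: real => _ [_ [H _]]; apply: H.
have FE a b : a < n -> b < n -> pedge F a b = adjG (nth d W' a) (nth d W' b).
  have memF c e : ((c, e) \in pE F) = adjG (nth d W' c) (nth d W' e) && (c < e < n).
    by rewrite mem_filter mem_pairs.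
  move=> lta ltb; rewrite /pedge !memF.
  rewrite [adjG (nth d W' b) _]adj_sym -/(adjG (nth d W' a) (nth d W' b)) lta ltb.
  case: (ltngtP a b) => [_|_|->] /=; rewrite ?andbT ?andbF ?orbF //.
  by rewrite /adjG irr.
have vW' a : a < n -> valid T L (nth d W' a).
  by move=> lta; apply: (allP vW); rewrite -mem_undup mem_nth.
have hinj u v : valid T L u -> valid T L v -> hvtx u = hvtx v -> u = v.
  by move=> vu vv' E; rewrite -(hvtxK vu) -(hvtxK vv') E.
have contF : contains adj F.
  pose g (u : rvert (fun _ : 'I_(nu F) => 1)) : rvert m :=
    match u with inl v => hvtx (nth d W' v) | inr _ => hv 0 end.
  exists (fun _ => 1), (fun u v => adj (g u) (g v)); split.
    split=> //; split; first by move=> u v; apply: adj_sym.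
    split; first by move=> u; apply: irr.
    split; first by move=> v w; rewrite FE //; apply: ltn_ord.
    have no (u : 'I_(nu F)) : False by case: u.
    do 3 (split; first by move=> v u; case: (no u)).
    by split; [|split] => u; case: (no u).
  exists g; split=> // -[v|[[]//]] [w|[[]//]] /= /hinj E; congr inl; apply: val_inj.
  apply/eqP; rewrite -(nth_uniq d _ _ (undup_uniq W)) ?ltn_ord //.
  by rewrite E //; apply: vW'; apply: ltn_ord.
have [] // : embeds M F.
  apply/embedsP; apply: contraPT contF => nE; apply: free.
  apply/In_filter; split.
    apply: graphs_filter; apply: leq_trans sW; exact: size_undup.
  by rewrite graph_of_wf /= nE.
move=> y [T' [L' [f [intended' vf fi fa]]]].
have ltW u : u \in W -> index u W' < n by rewrite index_mem mem_undup.
have nthW u : u \in W -> nth d W' (index u W') = u by move=> uW; rewrite nth_index ?mem_undup.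
exists y, T', L', (fun u => f (index u W')); split=> //.
- by move=> u uW; apply: vf; apply: ltW.
- move=> u v uW vW2 /fi E; rewrite -(nthW u uW) -(nthW v vW2) E //; exact: ltW.
- by move=> u v uW vW2; rewrite fa ?ltW // FE ?ltW // !nthW.
Qed.

End Extract.

Lemma free_iff_accept M x : 0 < vk M ->
  has_free_realization (host x) (forbidden M) <-> vaccepts M x.
Proof.
move=> k0; split=> [[m [adj [real free]]]|acc].
  exact: extract_accept real free.
apply: accept_free acc _ => F /In_filter[_ /and3P[_ _ /embedsP]]; exact.
Qed.

(** * Computing the instance *)

Definition code_cons e es := ESuc (EPair e es).

(** Inside [instance_expr] this stands at base 4, so the accumulator is register 5 and the index
    register 6; the spokes stand one base higher. *)
Definition input_edges_expr cE :=
  EIter (EVar 0) (ECst cE)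
    (code_cons (EPair (iter 21 ESuc (EVar 6)) (iter 22 ESuc (EVar 6)))
      (code_cons (EPair (ECst 18) (iter 22 ESuc (EVar 6))) (EVar 5))).

Definition input_spokes_expr cS :=
  EIter (EVar 0) (ECst cS)
    (code_cons (EPair (iter 22 ESuc (EVar 7)) (ECst 0)) (EVar 6)).

(* The codes of the constant parts of the host are kept as parameters: they are
   far too large for any reduction to reach them. *)
Definition instance_expr cE cS cR :=
  EPair
    (code_cons (iter 22 ESuc (EVar 0))
    (code_cons (ECst 2)
    (code_cons (input_edges_expr cE)
    (code_cons (input_spokes_expr cS)
    (code_cons (ECst cR)
    (code_cons
      (code_cons (EPair (ECst 12) (ECst 13))
      (code_cons (EPair (ECst 20) (iter 21 ESuc (EVar 0))) (ECst 0)))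
    (ECst 0)))))))
    (EVar 0).

Lemma instance_expr_wf cE cS cR : wf_expr 2 (instance_expr cE cS cR).
Proof. by []. Qed.

Lemma code_input_edges E x : code_pairs (input_edges E x) =
  iteri x (fun i acc => (cpair (cpair (21 + i) (22 + i))
                          (cpair (cpair 18 (22 + i)) acc).+1).+1) (code_pairs E).
Proof.
elim: x => [//|x IH]; rewrite iteriS -IH /input_edges iteriS.
by rewrite -/(input_edges E x).
Qed.

Lemma code_input_spokes S x : code_pairs (input_spokes S x) =
  iteri x (fun i acc => (cpair (cpair (22 + i) 0) acc).+1) (code_pairs S).
Proof.
elim: x => [//|x IH]; rewrite iteriS -IH /input_spokes iteriS.
by rewrite -/(input_spokes S x).
Qed.

Lemma ev_instance_expr cE cS cR x :
  ev 2 (instance_expr cE cS cR) (cinit x).2 =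
  cpair (code_seq [:: 22 + x; 2;
    iteri x (fun i acc => (cpair (cpair (21 + i) (22 + i))
                          (cpair (cpair 18 (22 + i)) acc).+1).+1) cE;
    iteri x (fun i acc => (cpair (cpair (22 + i) 0) acc).+1) cS; cR;
    code_pairs [:: (12, 13); (20, 21 + x)]]) x.
Proof. by []. Qed.

Theorem theorem2 :
  ~ (exists p, decides_on (fun _ _ => True) p) /\
  ~ (exists p, decides_on
       (fun H Fs => size (pR H) = 1 /\ all (fun F => nu F == 0) Fs) p).
Proof.
suff no_decider : ~ (exists p, decides_on
    (fun H Fs => size (pR H) = 1 /\ all (fun F => nu F == 0) Fs) p).
  by split=> // -[p Hp]; apply: no_decider; exists p => H Fs wH wF _; apply: Hp.
case=> p decp.
pose e := instance_expr (code_pairs core_edges) (code_pairs core_spokes)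
  (code_pairs [:: (0, 1)]).
(* [M] accepts an input exactly when the composed program answers 0 on it, in register 2. *)
have [M [k0 accM]] := vm_of_counter (precompose e p) 2.
pose x := code_seq (map code_pg (forbidden M)).
(* Self-reference: [x] is both the input held by the host and the code of the forbidden list of
   [M]. *)
have Ex : ev 2 e (cinit x).2 = code_inst (host x) (forbidden M).
  by rewrite ev_instance_expr -code_input_edges -code_input_spokes.
have [wF nF] : all wf_pg (forbidden M) /\ all (fun F => nu F == 0) (forbidden M).
  by split; apply: sub_all (filter_all _ _) => F /and3P[].
have [dec1 dec0] := decp (host x) (forbidden M) (host_wf x) wF (conj (erefl _) nF).
have halts y : halts_with p (code_inst (host x) (forbidden M)) y ->
    halts_reg (precompose e p) 2 x y.
  by rewrite -Ex; apply: precompose_halts; apply: instance_expr_wf.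
have free_iff := free_iff_accept x k0.
have nfree : ~ has_free_realization (host x) (forbidden M).
  move=> free; have h0 := (accM x).1 (free_iff.1 free).
  by have := halts_reg_inj h0 (halts 1 (dec1 free)).
by apply: (nfree); apply/free_iff/accM; apply: halts (dec0 nfree).
Qed.
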